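(* Let $(X,\mathsf d)$ be a proper geodesic metric space, $\varphi:X\to\mathbb R$ a Kantorovich potential for the cost $\mathsf d^2/2$, and $\gamma\in G_\varphi$ a $\varphi$-Kantorovich geodesic of positive length $\ell:=\ell(\gamma)>0$. Assume that for a.e. $t\in(0,1)$, $$(0,1)\ni\tau\mapsto\tilde\varphi_\tau(\gamma_t)\ \text{ is twice differentiable at }\tau=t\text{ for both }\tilde\varphi=\varphi,\bar\varphi,\qquad(\ast)$$ and that moreover $\partial_\tau^2|_{\tau=t}\varphi_\tau(\gamma_t)=\partial_\tau^2|_{\tau=t}\bar\varphi_\tau(\gamma_t)$ for a.e. $t\in(0,1)$. Furthermore, assume that the latter joint value coincides a.e. on $(0,1)$ with some continuous function $z_c$: $$\partial_\tau^2|_{\tau=t}\varphi_\tau(\gamma_t)=\partial_\tau^2|_{\tau=t}\bar\varphi_\tau(\gamma_t)=z_c(t)\quad\text{for a.e. }t\in(0,1).$$ Then $(\ast)$ holds for all $t\in(0,1)$, and $$\partial_\tau^2|_{\tau=t}\varphi_\tau(\gamma_t)=\partial_\tau^2|_{\tau=t}\bar\varphi_\tau(\gamma_t)=\partial_\tau|_{\tau=t}\frac{\ell_\tau^2}2(\gamma_t)=\partial_\tau|_{\tau=t}\frac{\bar\ell_\tau^2}2(\gamma_t)=z_c(t)\qquad\forall t\in(0,1).$$ Moreover, $$\frac{z_c(t)-z_c(s)}{t-s}\ge\sqrt{\frac st\,\frac{1-t}{1-s}}\;\frac{|z_c(s)|\,|z_c(t)|}{\ell^2}\qquad\forall\,0<s<t<1.$$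 In particular, for any point $t\in(0,1)$ where $z_c$ is differentiable, $z_c'(t)\ge\frac{z_c(t)^2}{\ell^2}$.
   Context: A metric space is proper if closed balls are compact. $\mathrm{Geo}(X)=\{\gamma:[0,1]\to X:\mathsf d(\gamma_s,\gamma_t)=|s-t|\,\mathsf d(\gamma_0,\gamma_1)\}$, $\ell(\gamma)=\mathsf d(\gamma_0,\gamma_1)$. The $c$-transform ($c=\mathsf d^2/2$) of $\psi:X\to\mathbb R\cup\{\pm\infty\}$ is $\psi^c(x)=\inf_{y}\frac{\mathsf d(x,y)^2}2-\psi(y)$. A Kantorovich potential is a function $\varphi:X\to\mathbb R\cup\{-\infty\}$, not identically $-\infty$, with $\varphi=\psi^c$ for some $\psi$; then $\varphi,\varphi^c$ are finite everywhere. For $t\in(0,1)$, $-\varphi_t(x)=\inf_y\frac{\mathsf d(x,y)^2}{2t}-\varphi(y)$ and $\bar\varphi_t(x)=\inf_y\frac{\mathsf d(x,y)^2}{2(1-t)}-\varphi^c(y)$. $G_\varphi=\{\gamma\in\mathrm{Geo}(X):\varphi(\gamma_0)+\varphi^c(\gamma_1)=\ell(\gamma)^2/2\}$. For $f:X\to\mathbb R\cup\{+\infty\}$ and $t>0$, with $Q_tf(x)=\inf_y\frac{\mathsf d(x,y)^2}{2t}+f(y)$, set $D_f^+(x,t)=\sup\limsup_n\mathsf d(x,y_n)$ and $D_f^-(x,t)=\inf\liminf_n\mathsf d(x,y_n)$, where sup and inf run over all minimizing sequences $\{y_n\}$ in the definition of $Q_tf(x)$. For $(x,t)\in X\times(0,1)$,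 $\ell_t^\pm(x)=D^\pm_{-\varphi}(x,t)/t$, $\bar\ell_t^\pm(x)=D^\pm_{-\varphi^c}(x,1-t)/(1-t)$. For $\tilde\ell\in\{\ell,\bar\ell\}$, $D_{\tilde\ell}(x)=\{t\in(0,1):\tilde\ell_t^+(x)=\tilde\ell_t^-(x)\}$ (it is co-countable in $(0,1)$), on which $\tilde\ell_t(x)$ is the common value. $\partial_\tau|_{\tau=t}\frac{\tilde\ell_\tau^2}2(\gamma_t)$ is the derivative at $\tau=t$ of the function $\tau\mapsto\tilde\ell_\tau(\gamma_t)^2/2$ on the set $D_{\tilde\ell}(\gamma_t)$ (which contains $t$), i.e. the limit of difference quotients along $\tau\in D_{\tilde\ell}(\gamma_t)$, $\tau\to t$. For fixed $x$, $\tau\mapsto\varphi_\tau(x)$ is locally semi-convex and $\tau\mapsto\bar\varphi_\tau(x)$ is locally semi-concave on $(0,1)$. A locally semi-convex or semi-concave function $f$ on an open interval is called twice differentiable at $\tau_0$, with $\frac{d^2}{d\tau^2}|_{\tau=\tau_0}f=\Delta\in\mathbb R$, if $f$ is differentiable at $\tau_0$ and $f(\tau_0+\epsilon)=f(\tau_0)+f'(\tau_0)\epsilon+\Delta\frac{\epsilon^2}2+o(\epsilon^2)$ as $\epsilon\to0$ (equivalently, $f'$, defined on the set of differentiability points of $f$, is differentiable at $\tau_0$ with derivative $\Delta$). *)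

(* Defs.v *)
From HB Require Import structures.
From mathcomp Require Import all_boot all_order all_algebra.
From mathcomp Require Import all_classical all_reals all_analysis.

Set Implicit Arguments.
Unset Strict Implicit.
Unset Printing Implicit Defensive.

Import Order.TTheory GRing.Theory Num.Theory.
Import numFieldNormedType.Exports.

Local Open Scope classical_set_scope.
Local Open Scope ring_scope.

Section metric.
Context {R : realType} {X : metricType R}.

(* The library's [closed_ball] is the closure of the open ball, which in a
   general metric space may be smaller than the set used here. *)
Definition proper_space : Prop :=
  forall (x : X) (r : R), compact [set y : X | mdist x y <= r].

(* A curve on [0, 1] is a function on [R] whose values outside [0, 1] are
   irrelevant. *)
Definition Geo : set (R -> X) :=
  [set g | forall s t, 0 <= s <= 1 -> 0 <= t <= 1 ->
     mdist (g s) (g t) = `|s - t| * mdist (g 0) (g 1)].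

Definition geodesic_space : Prop :=
  forall x y : X, exists2 g, Geo g & g 0 = x /\ g 1 = y.

Definition len (g : R -> X) : R := mdist (g 0) (g 1).

Local Open Scope ereal_scope.

Definition c_transform (psi : X -> \bar R) (x : X) : \bar R :=
  ereal_inf [set (mdist x y ^+ 2 / 2)%:E - psi y | y in [set: X]].

Definition kantorovich_potential (phi : X -> \bar R) : Prop :=
  [/\ forall x, phi x != +oo,
      exists x, phi x != -oo &
      exists psi : X -> \bar R, phi = c_transform psi].

Definition kantorovich_geodesics (phi : X -> \bar R) : set (R -> X) :=
  [set g | Geo g /\
     phi (g 0%R) + c_transform phi (g 1%R) = (len g ^+ 2 / 2)%:E].

Definition hopf_lax_at (f : X -> \bar R) (t : R) (x y : X) : \bar R :=
  (mdist x y ^+ 2 / (2 * t))%:E + f y.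

Definition hopf_lax (f : X -> \bar R) (t : R) (x : X) : \bar R :=
  ereal_inf [set hopf_lax_at f t x y | y in [set: X]].

Definition minimizing (f : X -> \bar R) (t : R) (x : X) : set (nat -> X) :=
  [set y | hopf_lax_at f t x (y n) @[n --> \oo] --> hopf_lax f t x].

Definition D_plus (f : X -> \bar R) (x : X) (t : R) : \bar R :=
  ereal_sup [set limn_esup (fun n => (mdist x (y n))%:E)
            | y in minimizing f t x].

Definition D_minus (f : X -> \bar R) (x : X) (t : R) : \bar R :=
  ereal_inf [set limn_einf (fun n => (mdist x (y n))%:E)
            | y in minimizing f t x].

(* When [phi] is a Kantorovich potential and [0 < t < 1], both interpolants are
   finite (each of [phi], [c_transform phi] is bounded above by a function
   [mdist x0 _ ^+ 2 / 2 + C]), so that [fine] only changes the type. *)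
Definition phi_t (phi : X -> \bar R) (t : R) (x : X) : R :=
  fine (- hopf_lax (fun y => - phi y) t x).

Definition phibar_t (phi : X -> \bar R) (t : R) (x : X) : R :=
  fine (hopf_lax (fun y => - c_transform phi y) (1 - t)%R x).

Definition ell_plus (phi : X -> \bar R) (t : R) (x : X) : \bar R :=
  D_plus (fun y => - phi y) x t * (t^-1)%:E.

Definition ell_minus (phi : X -> \bar R) (t : R) (x : X) : \bar R :=
  D_minus (fun y => - phi y) x t * (t^-1)%:E.

Definition ellbar_plus (phi : X -> \bar R) (t : R) (x : X) : \bar R :=
  D_plus (fun y => - c_transform phi y) x (1 - t)%R * ((1 - t)^-1)%:E.

Definition ellbar_minus (phi : X -> \bar R) (t : R) (x : X) : \bar R :=
  D_minus (fun y => - c_transform phi y) x (1 - t)%R * ((1 - t)^-1)%:E.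

Definition D_ell (phi : X -> \bar R) (x : X) : set R :=
  [set t | (0 < t < 1)%R /\ ell_plus phi t x = ell_minus phi t x].

Definition D_ellbar (phi : X -> \bar R) (x : X) : set R :=
  [set t | (0 < t < 1)%R /\ ellbar_plus phi t x = ellbar_minus phi t x].

(* Meaningful for [t] in [D_ell phi x], resp. [D_ellbar phi x]: the common value
   is then finite, since minimizing sequences exist and are bounded. *)
Definition ell (phi : X -> \bar R) (t : R) (x : X) : R :=
  fine (ell_plus phi t x).

Definition ellbar (phi : X -> \bar R) (t : R) (x : X) : R :=
  fine (ellbar_plus phi t x).

End metric.

Arguments proper_space {R} X.
Arguments geodesic_space {R} X.

Section derivatives.
Context {R : realType}.

(* Second-order Peano expansion; no first derivative is required away from
   [t]. *)
Definition is_derive2 (f : R -> R) (t Delta : R) : Prop :=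
  derivable f t 1 /\
  (fun e : R => f (t + e) - (f t + derive1 f t * e + Delta * (e ^+ 2 / 2)))
    =o_ (0 : R) (fun e : R => e ^+ 2).

Definition twice_differentiable (f : R -> R) (t : R) : Prop :=
  exists Delta, is_derive2 f t Delta.

(* [limit_point D t] excludes a vacuous limit; it holds for the co-countable sets
   [D_ell phi x] and [D_ellbar phi x]. *)
Definition is_derive_along (D : set R) (f : R -> R) (t l : R) : Prop :=
  [/\ D t, limit_point D t &
      (f tau - f t) / (tau - t) @[tau --> within D t^'] --> l].

End derivatives.

(* Main.v *)
(** The proof uses only the inequality [phi y + phi^c z <= d(y, z)^2 / 2], with
    equality at the endpoints of [gamma]; it is symmetric under exchanging
    [phi] and [phi^c] and reversing [gamma].  Write [U_t e], [V_t e] for the values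
    of [phi_(t+e)] and [phibar_(t+e)] at [gamma t], and [l] for the length.

    Then [U_t <= V_t] with equality at [e = 0], and using the endpoints of [gamma]
    as competitors sandwiches both between [U_t 0 + e l^2 / 2 +- C e^2].
    Moving from [gamma s] to [gamma t] costs [(t - s) l], so by Cauchy-Schwarz
    [e |-> U_t e + t l^2 / 2] and [e |-> V_t e + t l^2 / 2] are nondecreasing in
    [t].  Since their values at [e = 0] do not depend on [t], the second-order
    expansions known for a.e. parameter squeeze the one at [t], continuity of [zc]
    closing the gap.

    A function [- Q_tau f] is convex in [- 1 / tau], and [D^2 / 2] is a
    subgradient for every limit [D] of distances along minimizing sequences; hence
    a second-order expansion of the potential is a first-order expansion of
    [ell^2 / 2], also along approximate minimizers.

    Finally, let [y], [z] be approximate minimizers for [phi_(s+e)] at [gamma s] and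
    [phibar_(t+e)] at [gamma t], with speeds [a = d(gamma s, y) / (s + e)] and
    [b = d(gamma t, z) / (1 - t - e)].  Bounding [d(y, z)] by the length of the broken
    path through [gamma s], [gamma t] shows that [2 (V_t e - U_s e) + (t - s) l^2]
    is at least the variance of [a], [b], [l] under the weights [s + e],
    [1 - t - e], [t - s].  Dividing by [e^2] and letting [e] tend to 0 bounds
    [zc t - zc s] below by the variance of [zc s / l], [zc t / l], [0], and AM-GM
    gives the announced bound. *)

Require Import Defs.
From mathcomp Require Import all_boot all_order all_algebra.
From mathcomp Require Import all_classical all_reals all_analysis.
From mathcomp Require Import ring lra.

Import Order.TTheory GRing.Theory Num.Theory.
Import numFieldNormedType.Exports.

Set Implicit Arguments.
Unset Strict Implicit.
Unset Printing Implicit Defensive.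

Local Open Scope classical_set_scope.
Local Open Scope ring_scope.

(** * Second-order Peano expansions and subgradients in the variable [- 1 / tau] *)

Section peano_expansion.
Context {R : realType}.
Implicit Types (F : R -> R) (t p z : R).

Lemma sqr_normr (x : R) : `|x| ^+ 2 = x ^+ 2.
Proof. exact: real_normK (num_real x). Qed.

Lemma ler_of_sqr (x y : R) : 0 <= y -> x ^+ 2 <= y ^+ 2 -> x <= y.
Proof.
move=> y0; apply: contraLR; rewrite -!ltNge => yx.
by rewrite ltr_sqr ?nnegrE// ltW// (le_lt_trans y0).
Qed.

(** Epsilon-delta form of [is_derive2], with the slope [p] as an explicit datum in place of
    [derive1]. *)
Definition peano F t p z : Prop :=
  forall eta : R, 0 < eta -> exists2 r : R, 0 < r &
    forall e, `|e| < r ->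
      `|F (t + e) - (F t + p * e + z * (e ^+ 2 / 2))| <= eta * e ^+ 2.

Lemma is_derive_quadratic F t p (C r : R) : 0 < r ->
  (forall e, `|e| < r -> `|F (t + e) - (F t + p * e)| <= C * e ^+ 2) ->
  is_derive t 1 F p.
Proof.
move=> r0 FC.
have dF : h^-1 *: ((F \o shift t) (h *: (1 : R)) - F t) @[h --> 0^'] --> p.
  apply/cvgrPdist_le => eps eps0.
  (* [C] comes without a sign; [|C| + 1] is a safe positive divisor. *)
  have C1 : 0 < `|C| + 1 by rewrite ltr_wpDl.
  have d0 : 0 < Num.min r (eps / (`|C| + 1)).
    by rewrite lt_min r0 divr_gt0.
  near=> h.
  have h0 : h != 0 by near: h; exact: nbhs_dnbhs_neq.
  have : `|h| < Num.min r (eps / (`|C| + 1)).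
    by near: h; apply: dnbhs0_lt.
  rewrite lt_min ltr_pdivlMr// => /andP[hr hC].
  have hn : 0 < `|h| by rewrite normr_gt0.
  rewrite /= scaler1 [h + t]addrC /GRing.scale/=.
  have -> : p - h^-1 * (F (t + h) - F t) = - (F (t + h) - (F t + p * h)) / h.
    by field.
  rewrite normrM normrN normfV ler_pdivrMr//.
  apply: le_trans (FC _ hr) _.
  rewrite -(sqr_normr h) expr2 mulrA ler_pM2r//.
  have := ler_norm C; have := normr_ge0 h; nra.
apply: DeriveDef; first by apply/cvg_ex; exists p.
exact/cvg_lim.
Unshelve. all: by end_near. Qed.

(** The quadratic bound already forces the derivative at [t] to be [p], so both expansions have the
    same linear term. *)
Lemma is_derive2P F t p z (C r : R) : 0 < r ->
  (forall e, `|e| < r -> `|F (t + e) - (F t + p * e)| <= C * e ^+ 2) ->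
  is_derive2 F t z <-> peano F t p z.
Proof.
move=> r0 FC; have dF := is_derive_quadratic r0 FC.
have Ft : derive1 F t = p by rewrite derive1E; exact: derive_val.
rewrite /is_derive2 Ft; split.
  move=> [_ /eqoP Fo] eta eta0.
  have /nbhs_ballP[d /= d0 dF'] := Fo _ eta0.
  exists d => // e ed; have /= := dF' e;
    rewrite [X in _ <= _ * X]ger0_norm ?sqr_ge0//.
  by apply; rewrite /ball/= sub0r normrN.
move=> FP; split; first by case: dF.
apply/eqoP => eta eta0; have [d d0 Fd] := FP _ eta0.
apply/nbhs_ballP; exists d => // e; rewrite /ball/= sub0r normrN => ed.
by rewrite [X in _ <= _ * X]ger0_norm ?sqr_ge0//; exact: Fd.
Qed.

(* [w * (tau' - tau) * (tau / tau')] is what a subgradient of a function that is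
   convex in [- 1 / tau] contributes in the variable [tau]. *)
Lemma slope_step F tau w delta m A h : 0 <= A -> 0 < h -> h < tau ->
  w * h * (tau / (tau + h)) - delta <= F (tau + h) - F tau ->
  w * - h * (tau / (tau - h)) - delta <= F (tau - h) - F tau ->
  `|F (tau + h) - F tau - m * h| + delta <= A * h ->
  `|F (tau - h) - F tau + m * h| + delta <= A * h ->
  `|w - m| <= A + (`|m| + A) * (h / tau).
Proof.
move=> A0 h0 ht up dn Aup Adn.
have t0 : 0 < tau by lra.
have th0 : 0 < tau + h by lra.
have tn0 : 0 < tau - h by lra.
have wup : w * h * (tau / (tau + h)) <= (m + A) * h.
  by have := ler_norm (F (tau + h) - F tau - m * h); lra.
have wdn : (m - A) * h <= w * h * (tau / (tau - h)).
  by have := ler_norm (F (tau - h) - F tau + m * h); lra.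
have {}wup : w <= (m + A) * (1 + h / tau).
  have -> : w = (w * h * (tau / (tau + h))) * (h^-1 * ((tau + h) / tau)).
    by field; rewrite !lt0r_neq0.
  have -> : (m + A) * (1 + h / tau) = (m + A) * h * (h^-1 * ((tau + h) / tau)).
    by field; rewrite !lt0r_neq0.
  by rewrite ler_wpM2r// mulr_ge0 ?invr_ge0 ?divr_ge0// ltW.
have {}wdn : (m - A) * (1 - h / tau) <= w.
  have -> : w = (w * h * (tau / (tau - h))) * (h^-1 * ((tau - h) / tau)).
    by field; rewrite !lt0r_neq0.
  have -> : (m - A) * (1 - h / tau) = (m - A) * h * (h^-1 * ((tau - h) / tau)).
    by field; rewrite !lt0r_neq0.
  by rewrite ler_wpM2r// mulr_ge0 ?invr_ge0 ?divr_ge0// ltW.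
have k0 : 0 <= h / tau by rewrite divr_ge0// ltW.
have mk : m * (h / tau) <= `|m| * (h / tau) by rewrite ler_wpM2r// ler_norm.
have Ak : 0 <= A * (h / tau) by rewrite mulr_ge0.
by rewrite ler_norml; apply/andP; split; lra.
Qed.

(** Steps [h] and [- h] in [slope_step], with exact slopes and error [A = C h], give
    [|w - p| <= K h]; then [h] is taken below [eps / K]. *)
Lemma slope_center F t p z w : 0 < t < 1 -> peano F t p z ->
  (forall tau, 0 < tau < 1 -> w * (tau - t) * (t / tau) <= F tau - F t) ->
  w = p.
Proof.
move=> /andP[t0 t1] Fz Fw; apply/eqP;
  rewrite -subr_eq0 -normr_eq0 eq_le normr_ge0.
rewrite andbT; apply/ler_addgt0Pr => eps eps0; rewrite add0r.
have [r r0 Fr] := Fz 1 ltr01.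
(* The second-order term and the remainder at rate 1 together stay below [C h^2]. *)
pose C := `|z| / 2 + 1; have C0 : 0 < C by rewrite /C; have := normr_ge0 z; lra.
pose K := C + (`|p| + C) / t.
have K0 : 0 < K by rewrite /K addr_gt0// divr_gt0// ltr_wpDl.
pose h := Num.min (Num.min (r / 2) 1) (Num.min (Num.min (t / 2) ((1 - t) / 2))
    (eps / K)).
have h0 : 0 < h by rewrite /h !lt_min ltr01 !divr_gt0// subr_gt0.
have : h <= h by []; rewrite {2}/h !le_min =>
  /andP[/andP[hr h1] /andP[/andP[ht ht1] he]].
have hh e : `|e| = h -> `|F (t + e) - F t - p * e| + 0 <= C * h * h.
  move=> eh; have := Fr e; rewrite eh => /(_ ltac:(lra)).
  rewrite -(sqr_normr e) eh /C.
  have := ler_norm (z * (h ^+ 2 / 2));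
    rewrite normrM [`|h ^+ 2 / 2|]ger0_norm ?divr_ge0 ?sqr_ge0//.
  have := ler_norm (- (z * (h ^+ 2 / 2)));
    rewrite normrN normrM [`|h ^+ 2 / 2|]ger0_norm ?divr_ge0 ?sqr_ge0//.
  move=> ? ?; rewrite !ler_norml addr0 ler_norml => /andP[? ?]; apply/andP;
    split; lra.
have := @slope_step F t w 0 p (C * h) h (mulr_ge0 (ltW C0) (ltW h0)) h0.
move=> /(_ ltac:(lra)).
have := Fw (t + h) ltac:(lra); have := Fw (t - h) ltac:(lra).
rewrite ![t + _ - t]addrAC !subrr !add0r => Fwn Fwp.
rewrite !subr0 => /(_ Fwp Fwn).
have := hh h (ger0_norm (ltW h0)) => -> /(_ isT).
have := hh (- h); rewrite normrN mulrN opprK => -> //;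
  last exact: ger0_norm (ltW h0).
move=> /(_ isT) H.
apply: le_trans H _; rewrite ler_pdivlMr// in he.
apply: le_trans he.
have -> : h * K = C * h + (`|p| + C) * (h / t) by rewrite /K; field;
  rewrite lt0r_neq0.
by rewrite lerD2l ler_wpM2r ?divr_ge0 ?(ltW h0) ?(ltW t0)// lerD2l; nra.
Qed.

(** Steps of size [h = k |e|] around [t + e] are short compared with [e], yet long enough that
    errors of order [k^2 e^2], divided by [h], are only of order [k |e|]. The curvature term is of
    that order too, and [k] is small. The tolerance [|e|^3] leaves room for near minimizers. *)
Lemma slope_expansion F t p z : 0 < t < 1 -> peano F t p z ->
  forall eta, 0 < eta -> exists2 r, 0 < r &
    forall e w, 0 < `|e| < r ->
      (forall tau, 0 < tau < 1 ->
         w * (tau - (t + e)) * ((t + e) / tau) - `|e| ^+ 3 <=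
         F tau - F (t + e)) ->
      `|w - (p + z * e)| <= eta * `|e|.
Proof.
move=> /andP[t0 t1] Fz eta eta0.
(* Here [|z| / 2] stems from [z h^2 / 2]; the 2 counts the Peano remainders and the tolerance
   [|e|^3], each at most [k^2 e^2]. *)
pose C := `|z| / 2 + 2.
have C0 : 0 < C by rewrite /C; have := normr_ge0 z; lra.
pose K := C + (`|p| + `|z| + C) * (2 / t).
have K0 : 0 < K by rewrite /K addr_gt0// mulr_gt0 ?divr_gt0// ltr_wpDl// addr_ge0.
pose k := Num.min 1 (eta / K).
have k0 : 0 < k by rewrite /k lt_min ltr01 divr_gt0.
have : k <= k by []; rewrite {2}/k le_min ler_pdivlMr// => /andP[k1 kK].
(* The remainders at [e] and at [e + x], where [|e + x| <= 2 |e|], weigh 1 + 4 times this rate. *)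
have [r r0 Fr] := Fz (k ^+ 2 / 5) ltac:(by rewrite divr_gt0// exprn_gt0).
pose d := Num.min (Num.min (r / 2) (k ^+ 2)) (Num.min (t / 2) ((1 - t) / 2)).
exists d; first by rewrite /d !lt_min exprn_gt0// !divr_gt0// subr_gt0.
move=> e w; rewrite /d !lt_min => /andP[e0 /andP[/andP[er ek] /andP[et et1]]] Fw.
pose h := k * `|e|; have h0 : 0 < h by rewrite mulr_gt0.
have he : h <= `|e| by rewrite /h ger_pMl.
have := ler_norm e; have := ler_norm (- e); rewrite normrN => en1 en2.
have e2 : e ^+ 2 = `|e| ^+ 2 by rewrite sqr_normr.
have b0 : forall x, `|x| <= 2 * `|e| ->
    `|F (t + x) - (F t + p * x + z * (x ^+ 2 / 2))| <= k ^+ 2 / 5 * x ^+ 2.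
  by move=> x xe; apply: Fr; lra.
have key x : `|x| = h ->
    `|F (t + e + x) - F (t + e) - (p + z * e) * x| + `|e| ^+ 3
    <= (C * k * `|e|) * h.
  move=> xh.
  have exn : `|e + x| <= 2 * `|e|.
    by apply: le_trans (ler_normD _ _) _; rewrite xh; lra.
  have x2 : x ^+ 2 = h ^+ 2 by rewrite -sqr_normr xh.
  have ex2 : (e + x) ^+ 2 <= 4 * `|e| ^+ 2.
    by rewrite -sqr_normr; have := normr_ge0 (e + x); have := normr_ge0 e; nra.
  have := b0 _ exn; have := b0 e; rewrite e2 => /(_ ltac:(lra)).
  have e3 : `|e| ^+ 3 <= k ^+ 2 * `|e| ^+ 2.
    by rewrite exprS ler_wpM2r ?exprn_ge0// ltW.
  have k2 : 0 <= k ^+ 2 by exact: sqr_ge0.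
  have ke : k ^+ 2 / 5 * (e + x) ^+ 2 <= k ^+ 2 / 5 * (4 * `|e| ^+ 2).
    by rewrite ler_wpM2l// divr_ge0.
  have zz : `|z * (x ^+ 2 / 2)| = `|z| / 2 * h ^+ 2.
    by rewrite normrM x2 [`|_ / 2|]ger0_norm ?divr_ge0 ?sqr_ge0//; ring.
  have := ler_norm (z * (x ^+ 2 / 2)); have := ler_norm (- (z * (x ^+ 2 / 2))).
  rewrite normrN zz => zl zu.
  have -> : C * k * `|e| * h = `|z| / 2 * h ^+ 2 + 2 * (k ^+ 2 * `|e| ^+ 2).
    by rewrite /C /h; ring.
  rewrite !ler_norml => /andP[a1 a2] /andP[b1 b2].
  rewrite -lerBrDr ler_norml; rewrite !addrA in b1 b2 a1 a2 *.
  have ee : (e + x) ^+ 2 / 2 = e ^+ 2 / 2 + e * x + x ^+ 2 / 2 by field.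
  rewrite ee e2 in b1 b2.
  by apply/andP; split; lra.
have := @slope_step F (t + e) w (`|e| ^+ 3) (p + z * e) (C * k * `|e|) h
  (mulr_ge0 (mulr_ge0 (ltW C0) (ltW k0)) (ltW e0)) h0.
move=> /(_ ltac:(lra)).
have := Fw (t + e + h) ltac:(lra); have := Fw (t + e - h) ltac:(lra).
rewrite ![t + e + _ - (t + e)]addrAC !subrr !add0r => Fwn Fwp.
move=> /(_ Fwp Fwn (key h (ger0_norm (ltW h0)))).
have := key (- h); rewrite normrN mulrN opprK =>
  /(_ (ger0_norm (ltW h0))) kn /(_ kn) H.
apply: le_trans H _.
have kE : k * K * `|e| <= eta * `|e| by rewrite ler_wpM2r.
apply: le_trans kE.
have -> : k * K * `|e| = C * k * `|e| + (`|p| + `|z| + C) * (h / (t / 2)).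
  by rewrite /K /h; field; rewrite lt0r_neq0.
rewrite lerD2l.
have n1 : `|p + z * e| <= `|p| + `|z|.
  apply: le_trans (ler_normD _ _) _; rewrite lerD2l normrM ler_piMr//; lra.
have n2 : C * k * `|e| <= C.
  by rewrite -mulrA ger_pMr// mulr_ile1// ?(ltW k0)//; lra.
apply: ler_pM; [|by rewrite divr_ge0 ?ltW//; lra|by lra|].
  by rewrite addr_ge0// !mulr_ge0// ltW.
rewrite ler_wpM2l ?(ltW h0)// lef_pV2 ?posrE; lra.
Qed.

End peano_expansion.

(** * Eventual bounds on upper and lower limits *)

Section near_limits.
Context {R : realType}.
Local Open Scope ereal_scope.

Lemma limn_esup_le_near (u : nat -> \bar R) c :
  (\forall n \near \oo, u n <= c) -> limn_esup u <= c.
Proof.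
move=> uc; apply: ge_ereal_inf;
  exists (ereal_sup [set u n | n in [set n | u n <= c]]).
  by exists [set n | u n <= c].
by apply/ereal_supP => _ [n /= un <-].
Qed.

Lemma limn_einf_ge_near (u : nat -> \bar R) c :
  (\forall n \near \oo, c <= u n) -> c <= limn_einf u.
Proof.
move=> uc; rewrite /limn_einf leeNr; apply: limn_esup_le_near.
by near=> n; rewrite leeN2; near: n.
Unshelve. all: by end_near. Qed.

End near_limits.

(** * Hopf-Lax potentials and their near minimizers *)

Section potential.
Context {R : realType} {X : metricType R}.
Implicit Types (f : X -> \bar R) (x y : X) (t tau delta : R).

(** With [f = - phi] this is [phi_tau], with [f = - phi^c] it is [- phibar_(1 - tau)]. The sign
    makes it a supremum of functions affine in [- 1 / tau]. *)
Definition potential f x tau : R := - fine (hopf_lax f tau x).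

Lemma potential_ge f x tau y (r : R) : hopf_lax f tau x \is a fin_num ->
  f y = r%:E -> - (mdist x y ^+ 2 / (2 * tau)) - r <= potential f x tau.
Proof.
move=> fx fy; rewrite /potential -opprD lerN2 -lee_fin fineK//.
by apply: ereal_inf_lbound; exists y => //; rewrite /hopf_lax_at fy.
Qed.

Definition near_minimizer f x tau delta y : Prop :=
  exists2 r : R, f y = r%:E &
    potential f x tau - delta <= - (mdist x y ^+ 2 / (2 * tau)) - r.

Lemma near_minimizer_lt f x tau delta y : hopf_lax f tau x \is a fin_num ->
  (hopf_lax_at f tau x y < hopf_lax f tau x + delta%:E)%E ->
  near_minimizer f x tau delta y.
Proof.
move=> fx fy.
have fxy : (hopf_lax f tau x <= hopf_lax_at f tau x y)%E.
  by apply: ereal_inf_lbound; exists y.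
case E : (f y) => [r| |]; move: fy fxy; rewrite /hopf_lax_at E/=.
- rewrite -(fineK fx) -!EFinD lte_fin => fy _.
  by exists r => //; rewrite /potential; lra.
- by rewrite addey// -(fineK fx) -EFinD.
- by rewrite addeNy -(fineK fx).
Qed.

Lemma near_minimizer_exists f x tau delta : hopf_lax f tau x \is a fin_num ->
  0 < delta -> exists y, near_minimizer f x tau delta y.
Proof.
move=> fx d0; have [_ [y _ <-] yd] := lb_ereal_inf_adherent d0 fx.
by exists y; exact: near_minimizer_lt.
Qed.

(** [y] remains a competitor at time [tau'], where only the quadratic cost changes; the slope term
    is this change, [d^2 / (2 tau) - d^2 / (2 tau')]. *)
Lemma near_minimizer_slope f x tau delta y tau' :
  hopf_lax f tau' x \is a fin_num -> 0 < tau -> 0 < tau' ->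
  near_minimizer f x tau delta y ->
  (mdist x y / tau) ^+ 2 / 2 * (tau' - tau) * (tau / tau') - delta <=
  potential f x tau' - potential f x tau.
Proof.
move=> fx t0 t'0 [r fy yd]; have := potential_ge fx fy.
have -> : (mdist x y / tau) ^+ 2 / 2 * (tau' - tau) * (tau / tau') =
    mdist x y ^+ 2 / (2 * tau) - mdist x y ^+ 2 / (2 * tau').
  by field; rewrite !lt0r_neq0.
lra.
Qed.

Lemma minimizing_near f x tau delta (y : nat -> X) :
  hopf_lax f tau x \is a fin_num -> minimizing f tau x y -> 0 < delta ->
  \forall n \near \oo, near_minimizer f x tau delta (y n).
Proof.
move=> fx ym d0.
have : \forall n \near \oo, (hopf_lax_at f tau x (y n) < hopf_lax f tau x +
    delta%:E)%E.
  apply: (ym [set z | (z < hopf_lax f tau x + delta%:E)%E]).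
  apply: open_nbhs_nbhs; split; first exact: open_ereal_lt_ereal.
  by rewrite /= lteDl// lte_fin.
by apply: filterS => n; exact: near_minimizer_lt.
Qed.

Lemma minimizing_exists f x tau : hopf_lax f tau x \is a fin_num ->
  exists y : nat -> X, minimizing f tau x y.
Proof.
move=> fx.
have /choice[y yn] (n : nat) : exists y, near_minimizer f x tau (n.+1%:R^-1) y.
  exact: near_minimizer_exists.
exists y; rewrite /minimizing/=.
rewrite -(fineK fx); apply/fine_cvgP; split.
  by apply: nearW => n; have [r fy _] := yn n; rewrite /hopf_lax_at fy.
apply/cvgrPdist_le => e e0; near=> n.
have [r fy] := yn n; have := potential_ge fx fy.
rewrite /= /hopf_lax_at fy/= /potential => y1 y2.
have ne : (n.+1%:R^-1 : R) <= e.
  by apply: ltW; near: n; exact: near_infty_natSinv_lt (PosNum e0).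
have {}y2 := le_trans (lerB (lexx _) ne) y2.
by rewrite ler_norml; apply/andP; split; lra.
Unshelve. all: by end_near. Qed.

(** * Extremal limits of distances along minimizing sequences *)

Section distance_range.
Variables (f : X -> \bar R) (x : X).
Hypothesis ffin : forall tau, 0 < tau < 1 -> hopf_lax f tau x \is a fin_num.

Let F := potential f x.

(** Isolating [d ^+ 2] allows the slope inequality to be solved for the distance. *)
Let slope_weight tau tau' : 0 < tau -> 0 < tau' -> forall d : R,
  (d / tau) ^+ 2 / 2 * (tau' - tau) * (tau / tau') =
  d ^+ 2 * ((tau' - tau) / (2 * tau * tau')).
Proof. by move=> t0 t'0 d; field; rewrite !lt0r_neq0. Qed.

Lemma potential_nondecreasing tau tau' : 0 < tau -> tau < tau' -> tau' < 1 ->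
  F tau <= F tau'.
Proof.
move=> t0 tt' t'1.
have ft : hopf_lax f tau x \is a fin_num by apply: ffin; lra.
have ft' : hopf_lax f tau' x \is a fin_num by apply: ffin; lra.
have t'0 : 0 < tau' by lra.
apply/ler_addgt0Pr => e e0.
have [y ye] := @near_minimizer_exists f x tau e ft e0.
have := near_minimizer_slope ft' t0 t'0 ye.
rewrite slope_weight//.
have : 0 <= mdist x y ^+ 2 * ((tau' - tau) / (2 * tau * tau')).
  by rewrite mulr_ge0 ?sqr_ge0// divr_ge0// ?mulr_ge0//; lra.
rewrite -/F; lra.
Qed.

(** At a later time [tau'] the weight of [d ^+ 2] is positive, so the slope inequality bounds the
    distances of near minimizers from above. *)
Lemma D_plus_le tau tau' : 0 < tau -> tau < tau' -> tau' < 1 ->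
  (D_plus f x tau <=
   (Num.sqrt ((F tau' - F tau) / ((tau' - tau) / (2 * tau * tau'))))%:E)%E.
Proof.
move=> t0 tt' t'1.
have ft : hopf_lax f tau x \is a fin_num by apply: ffin; lra.
have ft' : hopf_lax f tau' x \is a fin_num by apply: ffin; lra.
have t'0 : 0 < tau' by lra.
set k := _ / (_ * tau'); set q := _ / k.
have k0 : 0 < k by rewrite divr_gt0 ?mulr_gt0//; lra.
have q0 : 0 <= q.
  by apply: divr_ge0 (ltW k0); rewrite subr_ge0 potential_nondecreasing.
apply/ereal_supP => _ [y ym <-]; apply/lee_addgt0Pr => e e0.
apply: limn_esup_le_near.
(* Division by [k] turns this tolerance into [e^2], which [(sqrt q + e)^2] absorbs. *)
have ke : 0 < k * e ^+ 2 by rewrite mulr_gt0// exprn_gt0.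
have := minimizing_near ft ym ke.
apply: filterS => n /(near_minimizer_slope ft' t0 t'0).
rewrite slope_weight// -/k -EFinD lee_fin.
have qk : F tau' - F tau = q * k by rewrite /q divfK// lt0r_neq0.
rewrite -/F qk => yq'.
have yq : mdist x (y n) ^+ 2 <= q + e ^+ 2 by rewrite -(ler_pM2r k0); lra.
have s0 := sqrtr_ge0 q; have s2 := sqr_sqrtr q0.
have se : 0 <= Num.sqrt q * e by rewrite mulr_ge0// ltW.
apply: ler_of_sqr; first lra.
rewrite sqrrD s2 -mulr_natr; lra.
Qed.

(** At an earlier time [tau'] the weight is negative, and the same inequality bounds the distances
    from below. *)
Lemma D_minus_ge tau tau' : 0 < tau' -> tau' < tau -> tau < 1 ->
  ((Num.sqrt ((F tau' - F tau) / ((tau' - tau) / (2 * tau * tau'))))%:E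
   <= D_minus f x tau)%E.
Proof.
move=> t'0 tt' t1.
have ft : hopf_lax f tau x \is a fin_num by apply: ffin; lra.
have ft' : hopf_lax f tau' x \is a fin_num by apply: ffin; lra.
have t0 : 0 < tau by lra.
set k := _ / (_ * tau'); set q := _ / k.
have k0 : k < 0.
  by rewrite /k ltr_pdivrMr ?mul0r ?subr_lt0// !mulr_gt0//; lra.
apply/ereal_infP => _ [y ym <-]; apply/lee_addgt0Pr => e e0.
rewrite -leeBlDr//; apply: limn_einf_ge_near.
have ke : 0 < - k * e ^+ 2 by rewrite mulr_gt0 ?oppr_gt0// exprn_gt0.
have := minimizing_near ft ym ke.
apply: filterS => n /(near_minimizer_slope ft' t0 t'0).
rewrite slope_weight//.
have qk : F tau' - F tau = q * k by rewrite /q divfK// ltr0_neq0.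
rewrite -/k -EFinB lee_fin -/F qk => qy'.
have qy : q <= mdist x (y n) ^+ 2 + e ^+ 2 by rewrite -(ler_nM2r k0); lra.
(* If [sqrt q <= e] the bound is trivial; otherwise [sqrt q > 0], and since [Num.sqrt] vanishes on
   negative numbers, [q >= 0]. *)
have [se|se] := leP (Num.sqrt q) e.
  by apply: le_trans (mdist_ge0 _ _); rewrite subr_le0.
have s0 := sqrtr_ge0 q.
have q0 : 0 <= q by rewrite leNgt; apply/negP => /ltW/ler0_sqrtr q0; lra.
have s2 := sqr_sqrtr q0.
have d0 := mdist_ge0 x (y n).
apply: ler_of_sqr => //; rewrite sqrrB s2 -mulr_natr.
have : e * e <= Num.sqrt q * e by rewrite ler_pM2r// ltW.
rewrite -expr2; lra.
Qed.

(** In the limit the slack of near minimizers disappears: both extremal distances give exact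
    subgradients, the input of [slope_center] and [slope_expansion]. *)
Lemma D_slope tau : 0 < tau < 1 -> exists M P : R,
  [/\ 0 <= M <= P, D_minus f x tau = M%:E, D_plus f x tau = P%:E,
      forall tau', 0 < tau' < 1 ->
        (M / tau) ^+ 2 / 2 * (tau' - tau) * (tau / tau') <= F tau' - F tau &
      forall tau', 0 < tau' < 1 ->
        (P / tau) ^+ 2 / 2 * (tau' - tau) * (tau / tau') <= F tau' - F tau].
Proof.
move=> t01; have /andP[t0 t1] := t01.
have [y ym] := minimizing_exists (ffin t01).
have DMP : (D_minus f x tau <= D_plus f x tau)%E.
  apply: le_trans (ereal_inf_lbound _) (le_trans (limn_einf_sup _)
      (ereal_sup_ubound _)).
    by exists y.
  by exists y.
have DM0 : (0 <= D_minus f x tau)%E.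
  apply/ereal_infP => _ [z _ <-]; apply: limn_einf_ge_near.
  by apply: nearW => n; rewrite lee_fin mdist_ge0.
have DPy : (D_plus f x tau < +oo)%E.
  (* Any time strictly between [tau] and 1 would serve for this bound. *)
  apply: le_lt_trans (@D_plus_le tau ((1 + tau) / 2) t0 _ _) _; [lra|lra|].
  exact: ltry.
have /fineK DPE : D_plus f x tau \is a fin_num.
  by rewrite fin_numElt DPy (lt_le_trans _ (le_trans DM0 DMP)).
have /fineK DME : D_minus f x tau \is a fin_num.
  by rewrite fin_numElt (lt_le_trans _ DM0)// (le_lt_trans DMP DPy).
set P := fine (D_plus f x tau) in DPE *; set M := fine (D_minus f x tau) in DME *.
have M0 : 0 <= M by rewrite -lee_fin DME.
have MP : M <= P by rewrite -lee_fin DME DPE.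
(* Looking forward only [d <= P] matters, looking backward only [M <= d]. *)
have slope d : M <= d <= P -> forall tau', 0 < tau' < 1 ->
    (d / tau) ^+ 2 / 2 * (tau' - tau) * (tau / tau') <= F tau' - F tau.
  move=> /andP[Md dP] tau' /andP[t'0 t'1]; rewrite slope_weight//.
  have d0 : 0 <= d by lra.
  have [tt'|tt'|->] := ltgtP tau tau'; last by rewrite !subrr mul0r mulr0.
  - have := @D_plus_le tau tau' t0 tt' t'1.
    rewrite -DPE lee_fin; set k := _ / (_ * tau') => dq.
    have k0 : 0 < k by rewrite divr_gt0 ?mulr_gt0//; lra.
    rewrite -ler_pdivlMr//.
    have q0 : 0 <= (F tau' - F tau) / k.
      by apply: divr_ge0 (ltW k0); rewrite subr_ge0 potential_nondecreasing.
    by rewrite -(sqr_sqrtr q0) ler_sqr ?nnegrE ?sqrtr_ge0//; lra.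
  - have := @D_minus_ge tau tau' t'0 tt' t1.
    rewrite -DME lee_fin; set k := _ / (_ * tau') => dq.
    have k0 : k < 0.
      by rewrite /k ltr_pdivrMr ?mul0r ?subr_lt0// !mulr_gt0//; lra.
    rewrite -ler_ndivrMr//.
    have [q0|q0] := leP 0 ((F tau' - F tau) / k).
      by rewrite -(sqr_sqrtr q0) ler_sqr ?nnegrE ?sqrtr_ge0//; lra.
    by rewrite (le_trans (ltW q0)) ?sqr_ge0.
exists M, P; split=> //; first by rewrite M0.
- by apply: slope; rewrite lexx.
- by apply: slope; rewrite MP lexx.
Qed.

(** The upper bound at [tau] and the lower bound at [tau'] are the same square root, its argument
    being symmetric in the two times. *)
Lemma D_plus_le_D_minus tau tau' : 0 < tau -> tau < tau' -> tau' < 1 ->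
  (D_plus f x tau <= D_minus f x tau')%E.
Proof.
move=> t0 tt' t'1.
have t'0 := lt_trans t0 tt'; have t1 := lt_trans tt' t'1.
apply: le_trans (D_plus_le t0 tt' t'1) _.
apply: le_trans (D_minus_ge t0 tt' t'1); rewrite lee_fin le_eqVlt; apply/orP;
  left.
apply/eqP; congr Num.sqrt.
by field; rewrite !subr_eq0 (gt_eqF tt') (lt_eqF tt') !lt0r_neq0.
Qed.

End distance_range.

End potential.

(** * Differentiating the squared speed *)

Section speed.
Context {R : realType} {X : metricType R}.
Implicit Types (f : X -> \bar R) (x : X) (t p z : R).

(** Chain rule for [tau |-> 1 - tau], which carries results on [- phi^c] over to [ellbar]. *)
Lemma is_derive_along_reflect (D : set R) (G : R -> R) t (l : R) :
  is_derive_along D G (1 - t) l ->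
  is_derive_along [set tau | D (1 - tau)] (fun tau => G (1 - tau)) t (- l).
Proof.
have BB (a : R) : 1 - (1 - a) = a by lra.
move=> [Dt lim cv]; split => //.
  move=> U /nbhs_ballP[e /= e0 eU].
  have [y [yt Dy Uy]] := lim _ (nbhsx_ballx (1 - t) e e0).
  exists (1 - y); split.
  - by apply: contra yt => /eqP <-; rewrite BB.
  - by rewrite /= BB.
  - apply: eU; rewrite /ball/=; have -> : t - (1 - y) = - (1 - t - y) by ring.
    by rewrite normrN.
apply/cvgrPdist_le => e e0.
move/cvgrPdist_le : cv => /(_ e e0).
move=> /nbhs_ballP[r /= r0 rP].
apply/nbhs_ballP; exists r => //= tau rtau taut Dtau.
have : ball (1 - t) r (1 - tau).
  rewrite /ball/=; have -> : 1 - t - (1 - tau) = - (t - tau) by ring.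
  by rewrite normrN.
move=> /rP; move=> /(_ _ Dtau).
have tt : 1 - tau != 1 - t by apply: contra taut => /eqP tt;
  rewrite -(BB tau) tt BB.
move=> /(_ tt)/=.
have -> : 1 - tau - (1 - t) = - (tau - t) by ring.
by rewrite invrN mulrN opprK -[leLHS]normrN opprD.
Qed.

(** Countable sets are Lebesgue null, whereas the interval has positive length. *)
Lemma exists_not_countable_itv (a b : R) (D : set R) : a < b ->
  countable (`]a, b[%classic `\` D) -> exists2 y, a < y < b & D y.
Proof.
move=> ab cD; apply/not_exists2P => nD.
have cab : countable `]a, b[%classic.
  apply: sub_countable cD; apply: subset_card_le => y yab; split => // Dy.
  by have := nD y; rewrite /= in_itv/= in yab *; rewrite yab; case.
have := countable_lebesgue_measure0 cab.
rewrite lebesgue_measure_itv/= lte_fin ab -EFinD => /eqP.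
by rewrite eqe subr_eq0 gt_eqF.
Qed.

Section along.
Variables (f : X -> \bar R) (x : X).
Hypothesis ffin : forall tau, 0 < tau < 1 -> hopf_lax f tau x \is a fin_num.

(** For [f = - phi] these are [ell_plus], [ell_minus] and [D_ell]; for [f = - phi^c] they are the
    barred versions at time [1 - tau]. *)
Let speed_plus tau := (D_plus f x tau * (tau^-1)%:E)%E.
Let speed_minus tau := (D_minus f x tau * (tau^-1)%:E)%E.
Let good := [set tau | 0 < tau < 1 /\ speed_plus tau = speed_minus tau].

(** By [D_plus_le_D_minus] the open intervals from [D_minus] to [D_plus] at different times are
    disjoint. Choosing a rational in each nonempty one injects the exceptional times to the right of
    [t] into the rationals, so good times accumulate at [t]. *)
Lemma good_limit_point t : 0 < t < 1 -> limit_point good t.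
Proof.
move=> /andP[t0 t1] U /nbhs_ballP[e /= e0 eU].
pose b := Num.min 1 (t + e).
have tb : t < b by rewrite lt_min t1 ltrDl.
have [|y /andP[ty yb] gy] := @exists_not_countable_itv t b good tb; last first.
  move: yb; rewrite lt_min => /andP[y1 ye].
  exists y; split => //; first by rewrite gt_eqF.
  by apply: eU; rewrite /ball/= distrC gtr0_norm ?subr_gt0// ltrBlDl.
have sep tau : exists q : rat, (`]t, b[%classic `\` good) tau ->
    (D_minus f x tau < (ratr q)%:E < D_plus f x tau)%E.
  have [[]|] := pselect ((`]t, b[%classic `\` good) tau); last by exists 0.
  rewrite /= in_itv/= lt_min => /andP[ttau /andP[tau1 _]] ntau.
  have tau01 : 0 < tau < 1 by rewrite tau1 (lt_trans t0).
  have [M [P [/andP[M0 MP] DM DP _ _]]] := D_slope ffin tau01.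
  have MP' : M < P.
    rewrite lt_neqAle MP andbT; apply/eqP => MPE; apply: ntau; split => //.
    by rewrite /speed_plus /speed_minus DM DP MPE.
  have [q] := rat_in_itvoo MP'; rewrite in_itv/= => Mq.
  by exists q => _; rewrite DM DP !lte_fin.
have {sep}[q qP] := choice sep.
apply/countable_injP; exists (pickle \o q) => tau1 tau2.
rewrite !inE => T1 T2 /= /(pcan_inj pickleK) q12.
have t1lt : forall s1 s2, (`]t, b[%classic `\` good) s1 ->
    (`]t, b[%classic `\` good) s2 -> q s1 = q s2 -> ~ (s1 < s2).
  move=> s1 s2 S1 S2 q12' s12.
  have /andP[_ q1] := qP _ S1; have /andP[q2 _] := qP _ S2.
  case: S1 S2 => [+ _] [+ _]; rewrite /= !in_itv/= !lt_min.
  move=> /andP[ts1 /andP[s11 _]] /andP[ts2 /andP[s21 _]].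
  have := D_plus_le_D_minus ffin (lt_trans t0 ts1) s12 s21.
  by rewrite leNgt (lt_trans q2)// -q12'.
have [l|l|//] := ltgtP tau1 tau2.
- by have := t1lt _ _ T1 T2 q12 l.
- by have := t1lt _ _ T2 T1 (esym q12) l.
Qed.

(** At [t], [slope_center] identifies both extremal half squared speeds with [p], so [t] is good. At
    a good [tau] near [t], the half squared speed is a subgradient, and [slope_expansion] gives its
    first-order behaviour. *)
Lemma speed_derive_along t p z : 0 < t < 1 -> peano (potential f x) t p z ->
  is_derive_along good (fun tau => fine (speed_plus tau) ^+ 2 / 2) t z.
Proof.
move=> t01 Fz.
have gt : good t /\ fine (speed_plus t) ^+ 2 / 2 = p.
  have [M [P [/andP[M0 MP] DM DP slM slP]]] := D_slope ffin t01.
  have Mp := slope_center t01 Fz slM; have Pp := slope_center t01 Fz slP.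
  rewrite /good /speed_plus /speed_minus /= DP DM /= Pp; split => //; split => //.
  have /andP[t0 t1] := t01.
  congr (_%:E * _)%E; apply: (divIf (lt0r_neq0 t0)).
  have /eqP := etrans Pp (esym Mp); rewrite (inj_eq (divIf _)) ?pnatr_eq0//.
  rewrite eqrXn2 ?divr_ge0 ?(ltW t0)//; first by move/eqP.
  exact: le_trans MP.
split; [exact: gt.1|exact: good_limit_point|].
apply/cvgrPdist_le => e e0; rewrite gt.2.
have [r r0 rP] := slope_expansion t01 Fz e0.
apply/nbhs_ballP; exists r => //= tau rtau taut gtau.
have [tau01 _] := gtau; have /andP[tau0 tau1] := tau01.
have d0 : 0 < `|tau - t| by rewrite normr_gt0 subr_eq0.
have [M [P [/andP[M0 MP] DM DP slM slP]]] := D_slope ffin tau01.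
have tE : t + (tau - t) = tau by lra.
have := rP (tau - t) ((P / tau) ^+ 2 / 2); rewrite tE.
move=> /(_ _)/wrap[].
  by rewrite d0/=; move: rtau; rewrite /ball/= distrC.
move=> /(_ _)/wrap[].
  move=> s s01; rewrite lerBlDr; apply: le_trans (slP _ s01) _.
  by rewrite lerDl exprn_ge0.
rewrite /speed_plus DP/= => H.
have -> : z - ((P / tau) ^+ 2 / 2 - p) / (tau - t) =
   - ((P / tau) ^+ 2 / 2 - (p + z * (tau - t))) / (tau - t).
  by field; rewrite subr_eq0 taut /= lt0r_neq0.
by rewrite normrM normrN normfV ler_pdivrMr.
Qed.

End along.
End speed.

(** * Dual pairs and their potentials *)

Section dual_pairs.
Context {R : realType} {X : metricType R}.
Implicit Types (f g : X -> \bar R) (gamma : R -> X).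

(* The functions [f] and [g] stand for [- phi] and [- phi^c]; the notion is
   symmetric under reversal of [gamma]. *)
Definition dual_pair f g gamma : Prop :=
  [/\ Geo gamma,
      forall y, f y != -oo%E, forall z, g z != -oo%E,
      forall y z (a b : R), f y = a%:E -> g z = b%:E ->
        0 <= a + b + mdist y z ^+ 2 / 2 &
      exists2 c : R, f (gamma 0) = (- c)%:E &
        g (gamma 1) = (c - len gamma ^+ 2 / 2)%:E].

Lemma Geo_reverse gamma : Geo gamma -> Geo (fun s => gamma (1 - s)).
Proof.
move=> G s t /andP[s0 s1] /andP[t0 t1]; rewrite G; [|lra|lra].
rewrite subr0 subrr [mdist (gamma 1) _]metric_sym distrC.
by have -> : 1 - t - (1 - s) = s - t by ring.
Qed.

Lemma len_reverse gamma : len (fun s => gamma (1 - s)) = len gamma.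
Proof. by rewrite /len subr0 subrr metric_sym. Qed.

Lemma dual_pair_sym f g gamma : dual_pair f g gamma ->
  dual_pair g f (fun s => gamma (1 - s)).
Proof.
move=> [G f0 g0 fg [c fc gc]]; split => //.
- exact: Geo_reverse.
- move=> y z a b ya zb; have := fg _ _ _ _ zb ya.
  by rewrite metric_sym [b + a]addrC.
- exists (len gamma ^+ 2 / 2 - c); first by rewrite subr0 gc opprB.
  by rewrite subrr fc len_reverse; congr _%:E; ring.
Qed.

(** Cauchy-Schwarz; the difference of the two sides is an explicit square over a positive number. *)
Lemma sqr_add_le (a b u v : R) : 0 < u -> 0 < v ->
  (a + b) ^+ 2 / (u + v) <= a ^+ 2 / u + b ^+ 2 / v.
Proof.
move=> u0 v0; rewrite -subr_ge0.
have -> : a ^+ 2 / u + b ^+ 2 / v - (a + b) ^+ 2 / (u + v) =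
    (a * v - b * u) ^+ 2 / (u * v * (u + v)).
  by field; rewrite !lt0r_neq0// addr_gt0.
by rewrite divr_ge0 ?sqr_ge0// !mulr_ge0 ?addr_ge0 ?ltW.
Qed.

(** The endpoint [gamma 0] is a competitor with finite value. Below, duality against [gamma 1]
    bounds [f y], and splitting [d(y, gamma 1)] at [x] into times [tau] and [1 - tau] cancels the
    cost of [y]. *)
Lemma hopf_lax_fin f g gamma x tau : dual_pair f g gamma -> 0 < tau < 1 ->
  hopf_lax f tau x \is a fin_num.
Proof.
move=> [_ f0 _ fg [c fc gc]] /andP[t0 t1]; rewrite fin_numElt; apply/andP; split.
  apply: (@lt_le_trans _ _ (- (c - len gamma ^+ 2 / 2)
      - mdist x (gamma 1) ^+ 2 / (2 * (1 - tau)))%:E); first exact: ltNyr.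
  apply/ereal_infP => _ [y _ <-]; rewrite /hopf_lax_at.
  case E : (f y) => [r| |]; last by have := f0 y; rewrite E.
    have := fg _ _ _ _ E gc; rewrite -EFinD lee_fin.
    have := @sqr_add_le (mdist x y) (mdist x (gamma 1)) tau (1 - tau) t0
        ltac:(lra).
    have -> : tau + (1 - tau) = 1 by lra.
    rewrite divr1 !invfM !mulrA.
    have := metric_triangle y x (gamma 1); rewrite [mdist y x]metric_sym => tr.
    have : mdist y (gamma 1) ^+ 2 <= (mdist x y + mdist x (gamma 1)) ^+ 2.
      by rewrite ler_sqr ?nnegrE ?addr_ge0 ?mdist_ge0.
    rewrite -![_ / 2 / _]mulrAC; lra.
  by rewrite addey// leey.
apply: le_lt_trans (ereal_inf_lbound _) _; first by exists (gamma 0).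
by rewrite /hopf_lax_at fc -EFinD ltry.
Qed.

(** This is [phi_tau <= phibar_tau]: near minimizers of the two problems are joined through [x], in
    times [tau] and [1 - tau]. *)
Lemma potential_add_le0 f g gamma x tau : dual_pair f g gamma -> 0 < tau < 1 ->
  potential f x tau + potential g x (1 - tau) <= 0.
Proof.
move=> fg t01; have /andP[t0 t1] := t01.
have t01' : 0 < 1 - tau < 1 by lra.
apply/ler_addgt0Pr => e e0; rewrite add0r.
have [y [a fy ya]] := @near_minimizer_exists _ _ f x tau _ (hopf_lax_fin x fg
    t01) (divr_gt0 e0 (ltr0n _ 2)).
have [z [b gz zb]] := @near_minimizer_exists _ _ g x (1 - tau) _ (hopf_lax_fin x
    (dual_pair_sym fg) t01') (divr_gt0 e0 (ltr0n _ 2)).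
have [_ _ _ /(_ _ _ _ _ fy gz) + _] := fg.
have := @sqr_add_le (mdist x y) (mdist x z) tau (1 - tau) t0 ltac:(lra).
have -> : tau + (1 - tau) = 1 by lra.
have := metric_triangle y x z; rewrite [mdist y x]metric_sym => tr.
have : mdist y z ^+ 2 <= (mdist x y + mdist x z) ^+ 2.
  by rewrite ler_sqr ?nnegrE ?addr_ge0 ?mdist_ge0.
move: ya zb; rewrite divr1 !invfM !mulrA -![_ / 2 / _]mulrAC; lra.
Qed.

(** * One potential along the geodesic *)

Section along_geodesic.
Variables (f g : X -> \bar R) (gamma : R -> X).
Hypothesis fg : dual_pair f g gamma.
Local Notation l := (len gamma).

Lemma geo_mdist s t : 0 <= s <= 1 -> 0 <= t <= 1 -> s <= t ->
  mdist (gamma s) (gamma t) = (t - s) * l.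
Proof.
by case: fg => G _ _ _ _ s01 t01 st; rewrite G// distrC ger0_norm ?subr_ge0.
Qed.

Lemma potential_geo_ge c t tau : f (gamma 0) = (- c)%:E -> 0 < t < 1 ->
  0 < tau < 1 -> c - t ^+ 2 * l ^+ 2 / (2 * tau) <= potential f (gamma t) tau.
Proof.
move=> fc t01 tau01; have := potential_ge (hopf_lax_fin (gamma t) fg tau01) fc.
rewrite metric_sym geo_mdist; [|lra|lra|lra].
by rewrite subr0 exprMn opprK addrC.
Qed.

(** A near minimizer seen from [gamma s] is reused from [gamma t]: the additional time [t - s] pays
    for the additional distance [(t - s) l] at cost [(t - s) l^2 / 2]. *)
Lemma potential_geo_nondecreasing s t e : 0 < s -> s <= t -> t < 1 ->
  0 < s + e -> t + e < 1 ->
  potential f (gamma s) (s + e) + s * (l ^+ 2 / 2) <=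
  potential f (gamma t) (t + e) + t * (l ^+ 2 / 2).
Proof.
move=> s0; rewrite le_eqVlt => /predU1P[->//|st] t1 se te.
apply/ler_addgt0Pr => d d0.
have [y [a fy ya]] := near_minimizer_exists (hopf_lax_fin (gamma s) fg (tau:=s +
    e) ltac:(lra)) d0.
have := potential_ge (hopf_lax_fin (gamma t) fg (tau:=t + e) ltac:(lra)) fy.
have := metric_triangle (gamma t) (gamma s) y.
rewrite [mdist (gamma t) (gamma s)]metric_sym geo_mdist; [|lra|lra|lra] => tr.
have := @sqr_add_le ((t - s) * l) (mdist (gamma s) y) (t - s) (s + e) ltac:(lra)
    se.
have -> : t - s + (s + e) = t + e by lra.
have -> : ((t - s) * l) ^+ 2 / (t - s) = (t - s) * l ^+ 2.
  by field; rewrite subr_eq0 gt_eqF.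
have : mdist (gamma t) y ^+ 2 / (t + e) <= ((t - s) * l + mdist (gamma s) y) ^+
    2 / (t + e).
  rewrite ler_pM2r ?invr_gt0; last lra.
  by rewrite ler_sqr ?nnegrE ?mdist_ge0// (le_trans _ tr)// mdist_ge0.
move: ya; rewrite !invfM !mulrA -![_ / 2 / _]mulrAC; lra.
Qed.

End along_geodesic.

(** * Estimates combining both potentials *)

Section symmetric_estimates.
Variables (f g : X -> \bar R) (gamma : R -> X).
Hypothesis fg : dual_pair f g gamma.
Local Notation l := (len gamma).

(** The competitor [gamma 0] gives the lower bound; the upper one is its mirror image for [g],
    transported by [potential_add_le0]. *)
Lemma potential_geo_sandwich c t tau : f (gamma 0) = (- c)%:E -> 0 < t < 1 ->
  0 < tau < 1 ->
  c - t ^+ 2 * l ^+ 2 / (2 * tau) <= potential f (gamma t) tau <=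
  c - l ^+ 2 / 2 + (1 - t) ^+ 2 * l ^+ 2 / (2 * (1 - tau)).
Proof.
move=> fc t01 tau01; rewrite (potential_geo_ge fg)//=.
have [_ _ _ _ [c' fc' gc]] := fg.
have cc' : c' = c by move: fc'; rewrite fc => -[/oppr_inj].
(* The argument [1 - 0] is the initial time of the reversed geodesic. *)
have gc' : g (gamma (1 - 0)) = (- (l ^+ 2 / 2 - c))%:E.
  by rewrite subr0 gc cc' opprB.
have := potential_geo_ge (dual_pair_sym fg) gc' (t:=1 - t) (tau:=1 - tau)
    ltac:(lra) ltac:(lra).
have := potential_add_le0 (gamma t) fg tau01.
rewrite len_reverse; have -> : 1 - (1 - t) = t by lra.
lra.
Qed.

Lemma potential_geo_center c t : f (gamma 0) = (- c)%:E -> 0 < t < 1 ->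
  potential f (gamma t) t = c - t * (l ^+ 2 / 2).
Proof.
move=> fc t01; have := potential_geo_sandwich fc t01 t01.
have -> : t ^+ 2 * l ^+ 2 / (2 * t) = t * (l ^+ 2 / 2) by field;
  rewrite !lt0r_neq0//; lra.
have -> : (1 - t) ^+ 2 * l ^+ 2 / (2 * (1 - t)) = (1 - t) * (l ^+ 2 / 2).
  by field; rewrite !lt0r_neq0//; lra.
by move=> /andP[? ?]; apply/eqP; rewrite eq_le; apply/andP; split; lra.
Qed.

(** Since [t^2 / (t + e) = t - e + e^2 / (t + e)], and likewise with [1 - t], the two sides of the
    sandwich share the tangent of slope [l^2 / 2]. The radius keeps both denominators above half
    their central values. *)
Lemma potential_geo_quadratic t : 0 < t < 1 -> exists C r : R, 0 < r /\
  forall e, `|e| < r ->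
    `|potential f (gamma t) (t + e) -
      (potential f (gamma t) t + l ^+ 2 / 2 * e)| <= C * e ^+ 2.
Proof.
move=> t01; have /andP[t0 t1] := t01; have [_ _ _ _ [c fc _]] := fg.
exists (l ^+ 2 / 2 * (2 / t + 2 / (1 - t))), (Num.min (t / 2) ((1 - t) / 2)).
split; first by rewrite lt_min !divr_gt0// subr_gt0.
move=> e; rewrite lt_min => /andP[]; rewrite !ltr_norml => et et1.
have := potential_geo_sandwich fc t01 (tau:=t + e) ltac:(lra).
rewrite (potential_geo_center fc t01).
have -> : t ^+ 2 * l ^+ 2 / (2 * (t + e)) =
    l ^+ 2 / 2 * (t - e) + l ^+ 2 / 2 * (e ^+ 2 / (t + e)) by field;
      rewrite !lt0r_neq0//; lra.
have -> : (1 - t) ^+ 2 * l ^+ 2 / (2 * (1 - (t + e))) =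
    l ^+ 2 / 2 * (1 - t + e) + l ^+ 2 / 2 * (e ^+ 2 / (1 - t - e)).
  by field; rewrite !lt0r_neq0//; lra.
have lt0 : 0 <= l ^+ 2 / 2 * e ^+ 2 by rewrite mulr_ge0 ?divr_ge0 ?sqr_ge0.
have b1 : l ^+ 2 / 2 * (e ^+ 2 / (t + e)) <= l ^+ 2 / 2 * e ^+ 2 * (2 / t).
  rewrite mulrA ler_wpM2l// -[2 / t]invf_div lef_pV2 ?posrE; lra.
have b2 : l ^+ 2 / 2 * (e ^+ 2 / (1 - t - e)) <= l ^+ 2 / 2 * e ^+ 2 * (2 / (1 -
    t)).
  rewrite mulrA ler_wpM2l// -[2 / (1 - t)]invf_div lef_pV2 ?posrE; lra.
have c1 : 0 <= l ^+ 2 / 2 * e ^+ 2 * (2 / t) by rewrite mulr_ge0// divr_ge0// ltW.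
have c2 : 0 <= l ^+ 2 / 2 * e ^+ 2 * (2 / (1 - t)).
  by rewrite mulr_ge0// divr_ge0//; lra.
move=> /andP[? ?]; rewrite ler_norml; apply/andP; split; lra.
Qed.

Lemma potential_geo_is_derive2 t z : 0 < t < 1 ->
  is_derive2 (potential f (gamma t)) t z <->
  peano (potential f (gamma t)) t (l ^+ 2 / 2) z.
Proof.
move=> /potential_geo_quadratic[C [r [r0 rC]]].
exact: is_derive2P r0 rC.
Qed.

(** By [potential_geo_nondecreasing] the expansion at [t] lies between those at [s0] and [s1], whose
    coefficients are close to [z t]. *)
Lemma peano_everywhere (z : R -> R) t : 0 < t < 1 ->
  (forall eta, 0 < eta -> exists s0 s1,
    [/\ 0 < s0 < t, t < s1 < 1,
        `|z s0 - z t| <= eta /\ `|z s1 - z t| <= eta &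
        peano (potential f (gamma s0)) s0 (l ^+ 2 / 2) (z s0) /\
        peano (potential f (gamma s1)) s1 (l ^+ 2 / 2) (z s1)]) ->
  peano (potential f (gamma t)) t (l ^+ 2 / 2) (z t).
Proof.
move=> t01 H eta eta0; have [_ _ _ _ [c fc _]] := fg.
have h0 : 0 < eta / 2 by rewrite divr_gt0.
have [s0 [s1 [s0t ts1 [z0 z1] [P0 P1]]]] := H _ h0.
have [r0 r00 R0] := P0 _ h0; have [r1 r10 R1] := P1 _ h0.
(* The bounds [s0] and [1 - s1] keep the shifted times inside the unit interval. *)
exists (Num.min (Num.min r0 r1) (Num.min s0 (1 - s1))).
  by rewrite !lt_min r00 r10/=; lra.
move=> e; rewrite !lt_min => /andP[/andP[er0 er1] /andP[]].
rewrite !ltr_norml => es0 es1.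
have := potential_geo_nondecreasing fg (s:=s0) (t:=t) (e:=e) ltac:(lra)
    ltac:(lra) ltac:(lra) ltac:(lra) ltac:(lra).
have := potential_geo_nondecreasing fg (s:=t) (t:=s1) (e:=e) ltac:(lra)
    ltac:(lra) ltac:(lra) ltac:(lra) ltac:(lra).
have := R0 _ er0; have := R1 _ er1.
rewrite !(potential_geo_center fc); [|lra|lra|lra].
have e2 : 0 <= e ^+ 2 by exact: sqr_ge0.
have := ler_wpM2r e2 z0; have := ler_wpM2r e2 z1.
rewrite -[X in `|_| * X](ger0_norm e2) -normrM ler_norml => /andP[? ?].
rewrite -[X in `|_| * X](ger0_norm e2) -normrM ler_norml => /andP[? ?].
rewrite !ler_norml => /andP[? ?] /andP[? ?] ? ?; apply/andP; split; lra.
Qed.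

(** The weights [s + e], [1 - (t + e)], [t - s] add up to 1, and the left side is the variance of
    [a], [b], [l], centred at [l]. It appears when the broken path bounds [d(y, z)] in the duality
    inequality. *)
Lemma near_minimizers_variance s t e delta y z (a b : R) :
  0 < s -> s < t -> t < 1 ->
  0 < s + e -> t + e < 1 ->
  near_minimizer f (gamma s) (s + e) delta y ->
  near_minimizer g (gamma t) (1 - (t + e)) delta z ->
  mdist (gamma s) y = (s + e) * a -> mdist (gamma t) z = (1 - (t + e)) * b ->
  (s + e) * (a - l) ^+ 2 + (1 - (t + e)) * (b - l) ^+ 2
    - ((s + e) * (a - l) + (1 - (t + e)) * (b - l)) ^+ 2 <=
  - 2 * (potential f (gamma s) (s + e) + potential g (gamma t) (1 - (t + e)))
    + (t - s) * l ^+ 2 + 4 * delta.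
Proof.
move=> s0 st t1 se te [r fy yr] [r' gz zr'] aE bE.
have [_ _ _ /(_ _ _ _ _ fy gz) + _] := fg.
have d1 := metric_triangle y (gamma s) z;
  have d2 := metric_triangle (gamma s) (gamma t) z.
have gst : mdist (gamma s) (gamma t) = (t - s) * l by rewrite (geo_mdist fg)//;
  lra.
rewrite [mdist y (gamma s)]metric_sym in d1; rewrite gst in d2.
have d0 := mdist_ge0 y z.
have : mdist y z ^+ 2 <= (mdist (gamma s) y + (t - s) * l + mdist (gamma t) z)
    ^+ 2.
  by rewrite ler_sqr ?nnegrE//; lra.
move: yr zr'; rewrite aE bE.
have -> : ((s + e) * a) ^+ 2 / (2 * (s + e)) = (s + e) * a ^+ 2 / 2 by field;
  rewrite !lt0r_neq0//; lra.
have -> : ((1 - (t + e)) * b) ^+ 2 / (2 * (1 - (t + e))) =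
    (1 - (t + e)) * b ^+ 2 / 2 by field; rewrite !lt0r_neq0//; lra.
lra.
Qed.

End symmetric_estimates.

End dual_pairs.

(** * Limit of the variance inequality and its consequence *)

Section variance.
Context {R : realType}.

(** With [q] the difference quotient of [a^2 / 2], the quotient of [a] is [2 q / (a + l)], where [q]
    tends to [z] and [a] to [l]. *)
Lemma cvg_sqrt_quotient (l z : R) (a e eta : nat -> R) : 0 < l ->
  (forall n, 0 <= a n) -> (forall n, 0 < e n) ->
  (forall n, `|a n ^+ 2 / 2 - (l ^+ 2 / 2 + z * e n)| <= eta n * e n) ->
  e n @[n --> \oo] --> (0 : R) -> eta n @[n --> \oo] --> (0 : R) ->
  (a n - l) / e n @[n --> \oo] --> z / l.
Proof.
move=> l0 a0 e0 ae ecv etacv.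
pose q n := (a n ^+ 2 / 2 - l ^+ 2 / 2) / e n.
have aq n : a n ^+ 2 = l ^+ 2 + 2 * (e n * q n).
  by rewrite /q; field; rewrite lt0r_neq0.
have qcv : q n @[n --> \oo] --> z.
  apply/cvgrPdist_le => d d0.
  move/cvgrPdist_le : etacv => /(_ d d0); apply: filterS => n.
  rewrite sub0r normrN => etad.
  have -> : z - q n = - (a n ^+ 2 / 2 - (l ^+ 2 / 2 + z * e n)) / e n.
    by rewrite /q; field; rewrite lt0r_neq0.
  rewrite normrM normrN normfV (gtr0_norm (e0 n)) ler_pdivrMr//.
  apply: le_trans (ae n) _; rewrite ler_pM2r//.
  exact: le_trans (ler_norm _) etad.
have acv : a n @[n --> \oo] --> l.
  have -> : a = (fun n => Num.sqrt (l ^+ 2 + 2 * (e n * q n))).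
    by apply/funext => n; rewrite -aq sqrtr_sqr ger0_norm.
  have : l ^+ 2 + 2 * (e n * q n) @[n --> \oo] --> l ^+ 2 + 2 * (0 * z).
    by apply: cvgD; [exact: cvg_cst|apply: cvgM; [exact: cvg_cst|exact: cvgM]].
  rewrite mul0r mulr0 addr0 => /(continuous_cvg _ (@sqrt_continuous R _)).
  by rewrite sqrtr_sqr gtr0_norm.
have -> : (fun n => (a n - l) / e n) = (fun n => 2 * q n / (a n + l)).
  apply/funext => n; rewrite /q; field.
  by rewrite !lt0r_neq0// ltr_wpDl.
have -> : z / l = 2 * z / (l + l) by field; rewrite !lt0r_neq0// addr_gt0.
apply: cvgM; first by apply: cvgM => //; exact: cvg_cst.
apply: cvgV; first by rewrite lt0r_neq0// addr_gt0.
by apply: cvgD => //; exact: cvg_cst.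
Qed.

(** Taking [eta = 1 / (n + 1)] and dividing by [e^2], the deviations [(a - l) / e] and [(b - l) / e]
    converge by [cvg_sqrt_quotient]. *)
Lemma variance_limit (s t l y z : R) : 0 < l ->
  (forall eta, 0 < eta -> exists e a b : R,
    [/\ 0 < e <= eta, 0 <= a /\ 0 <= b,
        `|a ^+ 2 / 2 - (l ^+ 2 / 2 + y * e)| <= eta * e,
        `|b ^+ 2 / 2 - (l ^+ 2 / 2 + z * e)| <= eta * e &
        (s + e) * (a - l) ^+ 2 + (1 - (t + e)) * (b - l) ^+ 2
          - ((s + e) * (a - l) + (1 - (t + e)) * (b - l)) ^+ 2
        <= (z - y + 8 * eta) * e ^+ 2]) ->
  s * (y / l) ^+ 2 + (1 - t) * (z / l) ^+ 2
    - (s * (y / l) + (1 - t) * (z / l)) ^+ 2 <= z - y.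
Proof.
move=> l0 H.
have /choice[eab eabP] (n : nat) : exists eab : R * R * R,
    let: (e, a, b) := eab in let eta : R := n.+1%:R^-1 in
    [/\ 0 < e <= eta, 0 <= a /\ 0 <= b,
        `|a ^+ 2 / 2 - (l ^+ 2 / 2 + y * e)| <= eta * e,
        `|b ^+ 2 / 2 - (l ^+ 2 / 2 + z * e)| <= eta * e &
        (s + e) * (a - l) ^+ 2 + (1 - (t + e)) * (b - l) ^+ 2
          - ((s + e) * (a - l) + (1 - (t + e)) * (b - l)) ^+ 2
        <= (z - y + 8 * eta) * e ^+ 2].
  have n0 : 0 < (n.+1%:R^-1 : R) by rewrite invr_gt0.
  by have [e [a [b P]]] := H _ n0; exists (e, a, b).
pose eta (n : nat) : R := n.+1%:R^-1.
pose e n := (eab n).1.1; pose a n := (eab n).1.2; pose b n := (eab n).2.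
have {}eabP n : [/\ 0 < e n <= eta n, 0 <= a n /\ 0 <= b n,
        `|a n ^+ 2 / 2 - (l ^+ 2 / 2 + y * e n)| <= eta n * e n,
        `|b n ^+ 2 / 2 - (l ^+ 2 / 2 + z * e n)| <= eta n * e n &
        (s + e n) * (a n - l) ^+ 2 + (1 - (t + e n)) * (b n - l) ^+ 2
          - ((s + e n) * (a n - l) + (1 - (t + e n)) * (b n - l)) ^+ 2
        <= (z - y + 8 * eta n) * e n ^+ 2].
  by have := eabP n; rewrite /e /a /b; case: (eab n) => [[? ?] ?].
have etacv : eta n @[n --> \oo] --> (0 : R) by exact: cvg_harmonic.
have e0 n : 0 < e n by have [/andP[]] := eabP n.
have ecv : e n @[n --> \oo] --> (0 : R).
  apply: (@squeeze_cvgr _ _ _ _ (cst 0) eta) => //; last exact: cvg_cst.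
  by apply: nearW => n; have [/andP[/ltW ? ?] _ _ _ _] := eabP n; apply/andP.
have acv : (a n - l) / e n @[n --> \oo] --> y / l.
  apply: (@cvg_sqrt_quotient l y a e eta) => // n.
    by have [_ [? ?] _ _ _] := eabP n.
  by have [_ _ ? _ _] := eabP n.
have bcv : (b n - l) / e n @[n --> \oo] --> z / l.
  apply: (@cvg_sqrt_quotient l z b e eta) => // n.
    by have [_ [? ?] _ _ _] := eabP n.
  by have [_ _ _ ? _] := eabP n.
have sqrcv (u : nat -> R) (v : R) :
  u n @[n --> \oo] --> v -> u n ^+ 2 @[n --> \oo] --> v ^+ 2.
  by move=> uv; under eq_fun do rewrite expr2; rewrite expr2; exact: cvgM.
pose A n := (a n - l) / e n; pose B n := (b n - l) / e n.
have scv : s + e n @[n --> \oo] --> s + 0 by apply: cvgD => //; exact: cvg_cst.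
have tcv : 1 - (t + e n) @[n --> \oo] --> 1 - (t + 0).
  by apply: cvgB; [exact: cvg_cst|apply: cvgD => //; exact: cvg_cst].
have Vcv : (s + e n) * A n ^+ 2 + (1 - (t + e n)) * B n ^+ 2
    - ((s + e n) * A n + (1 - (t + e n)) * B n) ^+ 2 @[n --> \oo] -->
    (s + 0) * (y / l) ^+ 2 + (1 - (t + 0)) * (z / l) ^+ 2
    - ((s + 0) * (y / l) + (1 - (t + 0)) * (z / l)) ^+ 2.
  apply: cvgB; first by apply: cvgD; apply: cvgM => //; exact: sqrcv.
  by apply: sqrcv; apply: cvgD; exact: cvgM.
have Zcv : z - y + 8 * eta n @[n --> \oo] --> z - y + 8 * 0.
  by apply: cvgD; [exact: cvg_cst|apply: cvgM => //; exact: cvg_cst].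
have := ler_cvg_to Vcv Zcv; rewrite !addr0 mulr0 addr0; apply.
apply: nearW => n; have [_ _ _ _ V] := eabP n.
rewrite -(ler_pM2r (exprn_gt0 2 (e0 n))); apply: le_trans V.
rewrite le_eqVlt; apply/orP; left; apply/eqP.
by rewrite /A /B; field; exact: lt0r_neq0 (e0 n).
Qed.

(** With [P^2 = s (1 - t)] and [Q^2 = t (1 - s)], the variance is at least [2 P (Q - P) |a b|],
    while [t - s = Q^2 - P^2 <= 2 Q (Q - P)]. *)
Lemma variance_sqrt_bound (s t l y z : R) : 0 < s -> s < t -> t < 1 -> 0 < l ->
  s * (y / l) ^+ 2 + (1 - t) * (z / l) ^+ 2
    - (s * (y / l) + (1 - t) * (z / l)) ^+ 2 <= z - y ->
  Num.sqrt ((s / t) * ((1 - t) / (1 - s))) * (`|y| * `|z| / l ^+ 2)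
    <= (z - y) / (t - s).
Proof.
move=> s0 st t1 l0 V.
have t0 : 0 < t by lra.
have s1 : 0 < 1 - s by lra.
have t1' : 0 < 1 - t by lra.
set a := y / l in V; set b := z / l in V.
have -> : `|y| * `|z| / l ^+ 2 = `|a| * `|b|.
  by rewrite /a /b !normrM !normfV (gtr0_norm l0); field; rewrite lt0r_neq0.
clearbody a b.
pose P := Num.sqrt (s * (1 - t)); pose Q := Num.sqrt (t * (1 - s)).
have P0 : 0 <= P by exact: sqrtr_ge0.
have Q0 : 0 < Q by rewrite sqrtr_gt0 mulr_gt0.
have P2 : P ^+ 2 = s * (1 - t) by rewrite sqr_sqrtr// mulr_ge0// ltW.
have Q2 : Q ^+ 2 = t * (1 - s) by rewrite sqr_sqrtr// mulr_ge0// ltW.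
have -> : Num.sqrt ((s / t) * ((1 - t) / (1 - s))) = P / Q.
  rewrite mulf_div sqrtrM ?sqrtrV//; first by rewrite mulr_ge0 ?ltW.
  by rewrite mulr_ge0 ?ltW.
have PQ : P <= Q by apply: ler_of_sqr (ltW Q0) _; rewrite P2 Q2; lra.
rewrite ler_pdivlMr ?subr_gt0//; apply: le_trans V.
have n0 : 0 <= `|a| * `|b| by rewrite mulr_ge0.
have nab : a * b <= `|a| * `|b| by rewrite -normrM ler_norm.
(* [s (1 - s) a^2 + t (1 - t) b^2 >= 2 P Q |a b|] by AM-GM *)
have amgm : 2 * (P * Q) * (`|a| * `|b|) <=
    s * (1 - s) * a ^+ 2 + t * (1 - t) * b ^+ 2.
  have := sqr_ge0 (Num.sqrt (s * (1 - s)) * `|a| - Num.sqrt (t * (1 - t)) * `|b|).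
  have -> : P * Q = Num.sqrt (s * (1 - s)) * Num.sqrt (t * (1 - t)).
    rewrite -!sqrtrM ?mulr_ge0 ?(ltW t0) ?(ltW s0) ?(ltW s1) ?(ltW t1')//.
    by congr Num.sqrt; ring.
  rewrite sqrrB !exprMn !sqr_normr !sqr_sqrtr ?mulr_ge0 ?(ltW t0) ?(ltW s0)
      ?(ltW s1) ?(ltW t1')//.
  by rewrite -mulr_natr; lra.
have st1 : s * (1 - t) * (a * b) <= P ^+ 2 * (`|a| * `|b|).
  by rewrite P2 ler_wpM2l// mulr_ge0// ltW.
have key : P / Q * (t - s) <= 2 * P * (Q - P).
  have -> : t - s = (Q - P) * (Q + P) by rewrite -subr_sqr P2 Q2; ring.
  rewrite mulrAC ler_pdivrMr//.
  have -> : 2 * P * (Q - P) * Q = P * (Q - P) * (2 * Q) by ring.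
  rewrite [P * (_ * _)]mulrA ler_wpM2l ?mulr_ge0 ?subr_ge0//; lra.
have := ler_wpM2r n0 key; lra.
Qed.

End variance.

(** * Time reversal and the variance bound for a dual pair *)

Section reflection.
Context {R : realType} {X : metricType R}.
Variables (f g : X -> \bar R) (gamma : R -> X).
Hypothesis fg : dual_pair f g gamma.
Local Notation l := (len gamma).

(** Negation and time reversal cancel in the slope; only negation affects the second-order
    coefficient. *)
Lemma peano_reflect (F : R -> R) (t p z : R) :
  peano F (1 - t) p z <-> peano (fun tau => - F (1 - tau)) t p (- z).
Proof.
have E e : - F (1 - (t + e)) - (- F (1 - t) + p * e + - z * (e ^+ 2 / 2)) =
    - (F (1 - t + - e) - (F (1 - t) + p * - e + z * ((- e) ^+ 2 / 2))).
  have -> : 1 - (t + e) = 1 - t + - e by ring.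
  by ring.
split=> H eta eta0; have [r r0 Hr] := H _ eta0; exists r => // e er.
- by rewrite E normrN -[X in _ <= _ * X]sqrrN; apply: Hr; rewrite normrN.
- have := Hr (- e); rewrite E normrN !opprK sqrrN !normrN; exact.
Qed.

Lemma potential_reflect_is_derive2 t z : 0 < t < 1 ->
  is_derive2 (fun tau => - potential g (gamma t) (1 - tau)) t z <->
  peano (potential g (gamma t)) (1 - t) (l ^+ 2 / 2) (- z).
Proof.
move=> t01.
have [C [r [r0]]] := potential_geo_quadratic (dual_pair_sym fg) (t:=1 - t)
    ltac:(lra).
rewrite len_reverse; have -> : 1 - (1 - t) = t by ring.
move=> Cr; apply: iff_trans (is_derive2P (p:=l ^+ 2 / 2) (C:=C) _ r0 _) _.
  move=> e er; have := Cr (- e); rewrite normrN sqrrN => /(_ er).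
  have -> : 1 - (t + e) = 1 - t + - e by ring.
  by rewrite -normrN; congr (`|_| <= _); ring.
by rewrite -[X in peano _ t _ X]opprK; exact: iff_sym (peano_reflect _ _ _ _).
Qed.

Lemma variance_bound s t y z : 0 < l -> 0 < s -> s < t -> t < 1 ->
  peano (potential f (gamma s)) s (l ^+ 2 / 2) y ->
  peano (potential g (gamma t)) (1 - t) (l ^+ 2 / 2) (- z) ->
  s * (y / l) ^+ 2 + (1 - t) * (z / l) ^+ 2
    - (s * (y / l) + (1 - t) * (z / l)) ^+ 2 <= z - y.
Proof.
move=> l0 s0 st t1 Py Pz; apply: variance_limit => // eta eta0.
have s01 : 0 < s < 1 by lra.
have t01 : 0 < 1 - t < 1 by lra.
have t01' : 0 < t < 1 by lra.
have [r1 r10 R1] := Py _ eta0; have [r2 r20 R2] := Pz _ eta0.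
have [r3 r30 R3] := slope_expansion s01 Py eta0.
have [r4 r40 R4] := slope_expansion t01 Pz eta0.
pose r := Num.min (Num.min (Num.min r1 r2) (Num.min r3 r4)) (Num.min eta (1 - t)).
have r0 : 0 < r by rewrite /r !lt_min r10 r20 r30 r40 eta0/=; lra.
pose e := r / 2.
have e0 : 0 < e by rewrite divr_gt0.
have : e < r by rewrite /e; lra.
rewrite {1}/r !lt_min => /andP[/andP[/andP[er1 er2] /andP[er3 er4]] /andP[eeta
    et]].
have te : t + e < 1 by lra.
have se : 0 < s + e by lra.
have se01 : 0 < s + e < 1 by lra.
have te0 : 0 < 1 - (t + e) by lra.
have te01 : 0 < 1 - (t + e) < 1 by lra.
(* The tolerance [e^3] is what [slope_expansion] admits, and it is at most [eta e^2]. *)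
have e30 : 0 < e ^+ 3 by rewrite exprn_gt0.
have ne : `|e| = e by rewrite gtr0_norm.
have [y' y'P] := near_minimizer_exists (hopf_lax_fin (gamma s) fg se01) e30.
have [z' z'P] := near_minimizer_exists (hopf_lax_fin (gamma t) (dual_pair_sym
    fg) te01) e30.
pose a := mdist (gamma s) y' / (s + e).
pose b := mdist (gamma t) z' / (1 - (t + e)).
have aE : mdist (gamma s) y' = (s + e) * a by rewrite /a mulrC divfK// lt0r_neq0.
have bE : mdist (gamma t) z' = (1 - (t + e)) * b.
  by rewrite /b mulrC divfK// lt0r_neq0.
exists e, a, b; split.
- by rewrite e0 ltW.
- by rewrite /a /b; split; apply: divr_ge0 => //;
  [exact: mdist_ge0|exact: ltW|exact: mdist_ge0|exact: ltW].
- have := R3 e (a ^+ 2 / 2); rewrite ne e0 er3 => /(_ isT).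
  apply => tau tau01; apply: near_minimizer_slope y'P => //.
    exact: hopf_lax_fin fg tau01.
  by have /andP[] := tau01.
(* In reversed time both the increment and the coefficient change sign, so the linear term is again
   [z e]. *)
- have := R4 (- e) (b ^+ 2 / 2); rewrite normrN ne e0 er4 mulrNN => /(_ isT).
  have -> : 1 - t + - e = 1 - (t + e) by ring.
  apply => tau tau01; apply: near_minimizer_slope z'P => //.
    exact: hopf_lax_fin (dual_pair_sym fg) tau01.
  by have /andP[] := tau01.
have := near_minimizers_variance fg s0 st t1 se te y'P z'P aE bE.
have := R1 e; rewrite ne => /(_ er1).
have := R2 (- e); rewrite normrN ne sqrrN => /(_ er2).
have [_ _ _ _ [c fc gc]] := fg.
have -> : 1 - t + - e = 1 - (t + e) by ring.
rewrite (potential_geo_center fg fc s01).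
have gc' : g (gamma (1 - 0)) = (- (l ^+ 2 / 2 - c))%:E.
  by rewrite subr0 gc opprB.
have := potential_geo_center (dual_pair_sym fg) gc' t01.
rewrite len_reverse; have -> : 1 - (1 - t) = t by ring.
move=> ->.
have e3 : e ^+ 3 <= eta * e ^+ 2 by rewrite exprS ler_wpM2r ?sqr_ge0 ?ltW.
(* Terms of order 0 and 1 in [e] cancel. The doubled Peano remainders give [4 eta e^2], and [4 e^3]
   gives the other half of [8 eta e^2]. *)
clear -e3; rewrite !ler_norml => /andP[? ?] /andP[? ?].
move=> H; apply: le_trans H _; lra.
Qed.

End reflection.

(** * Density of full-measure sets and one-sided derivative bounds *)

Section density.
Context {R : realType}.

Lemma ae_lebesgue_dense (P : R -> Prop) (a b : R) : a < b ->
  {ae @lebesgue_measure R, forall t, P t} -> exists2 t, a < t < b & P t.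
Proof.
move=> ab [A [mA A0 PA]]; apply/not_exists2P => nP.
have : (@lebesgue_measure R `]a, b[%classic <= lebesgue_measure A)%E.
  apply: le_measure; rewrite ?inE//.
  by move=> t; rewrite /= in_itv/= => tab; apply: PA => Pt; have := nP t;
    rewrite tab; case.
by rewrite A0 lebesgue_measure_itv/= lte_fin ab -EFinD lee_fin subr_le0 leNgt ab.
Qed.

Lemma derive1_ge_right (F : R -> R) (t c : R) (u : R -> R) : derivable F t 1 ->
  u h @[h --> 0^'+] --> c ->
  (\forall h \near 0^'+, u h <= (F (t + h) - F t) / h) -> c <= derive1 F t.
Proof.
move=> dF uc uF.
have Fcv : (F (t + h) - F t) / h @[h --> 0^'+] --> derive1 F t.
  apply: cvg_dnbhs_at_right; rewrite derive1E.
  have -> : (fun h => (F (t + h) - F t) / h) =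
      (fun h => h^-1 *: ((F \o shift t) (h *: (1 : R)) - F t)).
    by apply/funext => h; rewrite /= scaler1 [h + t]addrC [RHS]mulrC.
  exact: dF.
exact: ler_cvg_to uc Fcv uF.
Qed.

End density.

(** * Application to [phi] and its c-transform *)

Section kantorovich.
Context {R : realType} {X : metricType R}.
Variables (phi : X -> R) (gamma : R -> X).
Hypothesis hgamma : kantorovich_geodesics (EFin \o phi) gamma.
Local Notation f := (fun y : X => - (EFin \o phi) y)%E.
Local Notation g := (fun y : X => - c_transform (EFin \o phi) y)%E.

(** The infimum defining [phi^c] yields the duality inequality, and equality along [gamma] makes
    [phi^c (gamma 1)] finite; the constant is [phi (gamma 0)]. *)
Lemma dual_pair_potential : dual_pair f g gamma.
Proof.
have [G phiE] := hgamma.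
have cphi y z : (c_transform (EFin \o phi) z <= (mdist z y ^+ 2 / 2)%:E - (phi
    y)%:E)%E.
  by apply: ereal_inf_lbound; exists y.
split => //.
- move=> z; rewrite eqe_oppLR/= -ltey; apply: le_lt_trans (cphi z z) _.
  by rewrite -EFinB ltry.
- move=> y z a b [<-] gz; have := cphi y z.
  rewrite -[c_transform _ z]oppeK gz -EFinB -EFinN lee_fin metric_sym; lra.
exists (phi (gamma 0)) => //.
have cE : c_transform (EFin \o phi) (gamma 1) = (len gamma ^+ 2 / 2 - phi (gamma
    0))%:E.
  by rewrite EFinB -phiE/= addeAC -EFinB subrr add0e.
by rewrite cE -EFinN opprB.
Qed.

Lemma phi_tE x : (fun tau => phi_t (EFin \o phi) tau x) = potential f x.
Proof. by apply/funext => tau; rewrite /phi_t fineN. Qed.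

Lemma phibar_tE x :
  (fun tau => phibar_t (EFin \o phi) tau x) = (fun tau =>
    - potential g x (1 - tau)).
Proof. by apply/funext => tau; rewrite /potential opprK. Qed.

Lemma ell_is_derive_along t p z : 0 < t < 1 ->
  peano (potential f (gamma t)) t p z ->
  is_derive_along (D_ell (EFin \o phi) (gamma t))
    (fun tau => ell (EFin \o phi) tau (gamma t) ^+ 2 / 2) t z.
Proof.
move=> t01 Pz; apply: (speed_derive_along _ t01 Pz) => tau tau01.
exact: hopf_lax_fin dual_pair_potential tau01.
Qed.

Lemma ellbar_is_derive_along t p z : 0 < t < 1 ->
  peano (potential g (gamma t)) (1 - t) p (- z) ->
  is_derive_along (D_ellbar (EFin \o phi) (gamma t))
    (fun tau => ellbar (EFin \o phi) tau (gamma t) ^+ 2 / 2) t z.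
Proof.
move=> t01 Pz.
have t01' : 0 < 1 - t < 1 by lra.
have gfin tau : 0 < tau < 1 -> hopf_lax g tau (gamma t) \is a fin_num.
  exact: hopf_lax_fin (dual_pair_sym dual_pair_potential).
have := is_derive_along_reflect (speed_derive_along gfin t01' Pz).
rewrite opprK; congr (is_derive_along _ _ _ _).
apply/seteqP; split => tau /= [tau01 E]; split => //; lra.
Qed.

(** Good times are dense on both sides of [t], and continuity of [zc] brings their coefficients
    close to [zc t]; [peano_everywhere] then applies to the pair and to its reversal. *)
Lemma kantorovich_peano (zc : R -> R) :
  (forall t : R, 0 < t < 1 -> {for t, continuous zc}) ->
  {ae @lebesgue_measure R, forall t : R, 0 < t < 1 ->
     is_derive2 (fun tau => phi_t (EFin \o phi) tau (gamma t)) t (zc t) /\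
     is_derive2 (fun tau => phibar_t (EFin \o phi) tau (gamma t)) t (zc t)} ->
  forall t, 0 < t < 1 ->
    peano (potential f (gamma t)) t (len gamma ^+ 2 / 2) (zc t) /\
    peano (potential g (gamma t)) (1 - t) (len gamma ^+ 2 / 2) (- zc t).
Proof.
move=> zcont hae t t01; have fg := dual_pair_potential.
have near_good eta : 0 < eta -> exists s0 s1,
    [/\ 0 < s0 < t, t < s1 < 1,
        `|zc s0 - zc t| <= eta /\ `|zc s1 - zc t| <= eta &
        forall s, s = s0 \/ s = s1 ->
        peano (potential f (gamma s)) s (len gamma ^+ 2 / 2) (zc s) /\
        peano (potential g (gamma s)) (1 - s) (len gamma ^+ 2 / 2) (- zc s)].
  move=> eta0; have /cvgrPdist_le/(_ _ eta0) := zcont _ t01.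
  move=> /nbhs_ballP[d /= d0 dP].
  have good s : 0 < s < 1 -> (0 < s < 1 ->
     is_derive2 (fun tau => phi_t (EFin \o phi) tau (gamma s)) s (zc s) /\
     is_derive2 (fun tau => phibar_t (EFin \o phi) tau (gamma s)) s (zc s)) ->
     peano (potential f (gamma s)) s (len gamma ^+ 2 / 2) (zc s) /\
     peano (potential g (gamma s)) (1 - s) (len gamma ^+ 2 / 2) (- zc s).
    move=> s01 /(_ s01); rewrite phi_tE phibar_tE => -[].
    move=> /(potential_geo_is_derive2 fg _ s01) ?.
    by move=> /(potential_reflect_is_derive2 fg _ s01) ?.
  have lt0 : Num.max 0 (t - d) < t.
    by rewrite gt_max; apply/andP; split; [lra|rewrite ltrBlDr ltrDl].
  have lt1 : t < Num.min 1 (t + d).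
    by rewrite lt_min; apply/andP; split; [lra|rewrite ltrDl].
  have [s0 /andP[+ s0t] P0] := ae_lebesgue_dense lt0 hae.
  have [s1 /andP[ts1 +] P1] := ae_lebesgue_dense lt1 hae.
  rewrite gt_max lt_min => /andP[s11 s1d] /andP[s00 s0d].
  have s001 : 0 < s0 < 1 by lra.
  have s101 : 0 < s1 < 1 by lra.
  exists s0, s1; split.
  - by rewrite s00.
  - by rewrite ts1.
  - by split; rewrite distrC; apply: dP; rewrite /ball/= ltr_norml; apply/andP;
    split; lra.
  - by move=> s [->|->]; apply: good.
split.
  apply: (peano_everywhere fg t01) => eta eta0.
  have [s0 [s1 [s0t ts1 z01 P]]] := near_good _ eta0; exists s0, s1; split => //.
  by split; [apply: (P s0 _).1; left|apply: (P s1 _).1; right].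
have BB (s : R) : 1 - (1 - s) = s by ring.
have t01' : 0 < 1 - t < 1 by lra.
have := peano_everywhere (dual_pair_sym fg) (z:=fun s => - zc (1 - s)) t01'.
rewrite len_reverse BB; apply => eta eta0.
have [s0 [s1 [s0t ts1 [z0 z1] P]]] := near_good _ eta0.
(* Reversal exchanges the left and right neighbours. *)
exists (1 - s1), (1 - s0); rewrite !BB; split; [lra|lra| |].
- by rewrite -!opprD !normrN.
- by split; [apply: (P s1 _).2; right|apply: (P s0 _).2; left].
Qed.

End kantorovich.

(** * The differential inequality *)

Section main_inequality.
Context {R : realType}.

(** Fix the left point at [t] and let the right one decrease to it: the square root tends to 1 and
    the product to [z t ^+ 2]. *)
Lemma derive1_sqr_bound (z : R -> R) (t l : R) : 0 < t < 1 ->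
  {for t, continuous z} -> derivable z t 1 ->
  (forall s r : R, 0 < s -> s < r -> r < 1 ->
     Num.sqrt ((s / r) * ((1 - r) / (1 - s))) * (`|z s| * `|z r| / l ^+ 2)
     <= (z r - z s) / (r - s)) ->
  z t ^+ 2 / l ^+ 2 <= derive1 z t.
Proof.
move=> /andP[t0 t1] zt dz H.
pose u h := Num.sqrt ((t / (t + h)) * ((1 - (t + h)) / (1 - t)))
  * (`|z t| * `|z (t + h)| / l ^+ 2).
have t1' : 0 < 1 - t by rewrite subr_gt0.
have th : t + h @[h --> (0 : R)] --> t.
  by rewrite -[X in _ --> X]addr0; apply: cvgD; [exact: cvg_cst|exact: cvg_id].
have ucv : u h @[h --> 0^'+] --> z t ^+ 2 / l ^+ 2.
  have -> : z t ^+ 2 / l ^+ 2 =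
      Num.sqrt ((t / t) * ((1 - t) / (1 - t))) * (`|z t| * `|z t| / l ^+ 2).
    by rewrite !divff ?lt0r_neq0// mulr1 sqrtr1 mul1r -expr2 sqr_normr.
  apply: cvg_at_right_filter; apply: cvgM.
    apply: continuous_cvg; first exact: sqrt_continuous.
    apply: cvgM; first by apply: cvgM; [exact: cvg_cst|apply: cvgV => //;
      rewrite lt0r_neq0].
    by apply: cvgM; [apply: cvgB => //; exact: cvg_cst|exact: cvg_cst].
  apply: cvgM; last exact: cvg_cst.
  apply: cvgM; first exact: cvg_cst.
  by apply: cvg_norm; exact: (continuous_cvg _ zt th).
apply: derive1_ge_right dz ucv _.
near=> h.
have h0 : 0 < h by near: h; exact: nbhs_right_gt.
have h1 : h < 1 - t by near: h; exact: nbhs_right_lt.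
have := H t (t + h) t0 ltac:(lra) ltac:(lra).
by have -> : t + h - t = h by ring.
Unshelve. all: by end_near. Qed.

End main_inequality.

Theorem theorem5p5 (R : realType) (X : metricType R)
  (hproper : proper_space X) (hgeod : geodesic_space X)
  (phi : X -> R) (hphi : kantorovich_potential (EFin \o phi))
  (gamma : R -> X) (hgamma : kantorovich_geodesics (EFin \o phi) gamma)
  (hlen : 0 < len gamma)
  (htwice : {ae @lebesgue_measure R, forall t : R, 0 < t < 1 ->
     twice_differentiable (fun tau => phi_t (EFin \o phi) tau (gamma t)) t /\
     twice_differentiable (fun tau => phibar_t (EFin \o phi) tau (gamma t)) t})
  (hjoint : {ae @lebesgue_measure R, forall t : R, 0 < t < 1 ->
     exists2 Delta : R,
       is_derive2 (fun tau => phi_t (EFin \o phi) tau (gamma t)) t Delta &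
       is_derive2 (fun tau => phibar_t (EFin \o phi) tau (gamma t)) t Delta})
  (zc : R -> R) (hzc : forall t : R, 0 < t < 1 -> {for t, continuous zc})
  (hjointzc : {ae @lebesgue_measure R, forall t : R, 0 < t < 1 ->
     is_derive2 (fun tau => phi_t (EFin \o phi) tau (gamma t)) t (zc t) /\
     is_derive2 (fun tau => phibar_t (EFin \o phi) tau (gamma t)) t (zc t)}) :
  [/\ forall t : R, 0 < t < 1 ->
        twice_differentiable (fun tau => phi_t (EFin \o phi) tau (gamma t)) t /\
        twice_differentiable (fun tau => phibar_t (EFin \o phi) tau (gamma t)) t,
      forall t : R, 0 < t < 1 ->
        [/\ is_derive2
              (fun tau => phi_t (EFin \o phi) tau (gamma t)) t (zc t),
            is_derive2
              (fun tau => phibar_t (EFin \o phi) tau (gamma t)) t (zc t),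
            is_derive_along (D_ell (EFin \o phi) (gamma t))
              (fun tau => ell (EFin \o phi) tau (gamma t) ^+ 2 / 2) t (zc t) &
            is_derive_along (D_ellbar (EFin \o phi) (gamma t))
              (fun tau => ellbar (EFin \o phi) tau (gamma t) ^+ 2 / 2) t (zc t)],
      forall s t : R, 0 < s -> s < t -> t < 1 ->
        Num.sqrt ((s / t) * ((1 - t) / (1 - s)))
          * (`|zc s| * `|zc t| / len gamma ^+ 2)
        <= (zc t - zc s) / (t - s) &
      forall t : R, 0 < t < 1 -> derivable zc t 1 ->
        zc t ^+ 2 / len gamma ^+ 2 <= derive1 zc t].

Proof.
have P := kantorovich_peano hgamma hzc hjointzc.
have fg := dual_pair_potential hgamma.
have C t : 0 < t < 1 ->
    is_derive2 (fun tau => phi_t (EFin \o phi) tau (gamma t)) t (zc t) /\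
    is_derive2 (fun tau => phibar_t (EFin \o phi) tau (gamma t)) t (zc t).
  move=> t01; have [Pf Pg] := P t t01; rewrite phi_tE phibar_tE; split.
    exact/(potential_geo_is_derive2 fg _ t01).
  exact/(potential_reflect_is_derive2 fg _ t01).
have I s t : 0 < s -> s < t -> t < 1 ->
    Num.sqrt ((s / t) * ((1 - t) / (1 - s)))
      * (`|zc s| * `|zc t| / len gamma ^+ 2) <= (zc t - zc s) / (t - s).
  move=> s0 st t1; apply: variance_sqrt_bound => //.
  have [Ps _] := P s ltac:(lra); have [_ Pt] := P t ltac:(lra).
  exact: (variance_bound fg hlen s0 st t1 Ps Pt).
split => //.
- by move=> t /C[C1 C2]; split; exists (zc t).
- move=> t t01; have [C1 C2] := C t t01; have [Pf Pg] := P t t01; split => //.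
    exact: (ell_is_derive_along hgamma t01 Pf).
  exact: (ellbar_is_derive_along hgamma t01 Pg).
- by move=> t t01 dz; apply: derive1_sqr_bound => //; exact: hzc.
Qed.
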